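(* Let $T_{\min}>0$, assume Isaacs' condition, and assume that the flow and jump data depend only on the timer $\tau=t-t_k$, that the flow data are time-invariant beyond $T_{\min}$, and that the jump data are $k$-independent: $$\mathcal F(\tau,\cdot)\equiv\mathcal F_\infty(\cdot),\quad Z(\tau)\equiv Z(T_{\min})\ (\tau\ge T_{\min}),\qquad \mathcal J(k,\cdot)\equiv\mathcal J(\cdot),\quad Z_k\equiv Z_{\mathrm{jp}}\ \forall k.$$ Suppose there exists a piecewise-$C^1$ function $P_s:[0,T_{\min}]\to\mathbb H^n_{\succeq0}$ satisfying: (i) for $\tau\in(0,T_{\min})$, $\mathcal I=\mathcal I(\tau,P_s(\tau))$ satisfies $\mathcal I_{11}-\mathcal I_{1g}\mathcal G^\dagger\mathcal I_{1g}^*=0$ and Isaacs' condition; (ii) $\mathcal I^{\mathrm j}=\mathcal I^{\mathrm j}(P_s(0^+),P_s(T_{\min}))$ satisfies Isaacs' condition and $\mathcal I^{\mathrm j}_{11}-\mathcal I^{\mathrm j}_{1g}(\mathcal G^{\mathrm j})^\dagger(\mathcal I^{\mathrm j}_{1g})^*=0$; (iii) (Geromel–Colaneri condition) the frozen matrix $\mathcal I^0:=\mathcal F_\infty^*(P_s(T_{\min}))+Z(T_{\min})$, with Isaacs block $\mathcal G^0$, satisfies Isaacs' condition and $\mathcal I^0_{11}-\mathcal I^0_{1g}(\mathcal G^0)^\dagger(\mathcal I^0_{1g})^*\preceq0$. Then the causal saddle-point policy with gains in $(\mathcal K_u^s\times\mathcal K_w^s)(\tau,P_s(\tau))$ for $\tau\le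 T_{\min}$ and frozen at $\tau=T_{\min}$ for $\tau>T_{\min}$ achieves $J_T^\circ(X_1^0)\le\langle P_s(0),X_1^0\rangle$ for every dwell-time sequence with all $\Delta_k=t_{k+1}-t_k\ge T_{\min}$.
   Context: Notation. Fix integers $n,m_u,m_w\ge1$, $m=m_u+m_w$. $\mathbb H^p$, $\mathbb H^p_{\succeq0}$: $p\times p$ complex Hermitian, resp. positive semidefinite, matrices; $\langle A,B\rangle=\operatorname{trace}(AB^* )$; $A^\dagger$ is the Moore–Penrose pseudoinverse. $E=[I_n\ \ 0]\in\mathbb C^{n\times(n+m)}$. Partition $X\in\mathbb H^{n+m}$ with block sizes $n,m_u,m_w$ as $X=\begin{bmatrix}X_1&X_{12}^*&X_{13}^*\\ X_{12}&X_{22}&X_{23}^*\\ X_{13}&X_{23}&X_{33}\end{bmatrix}$, $X_1=EXE^*$. System. Initial time $t_0$, jump times $t_1<t_2<\cdots$, $t_k\to\infty$; timer $\tau(t)=t-t_k$ on $[t_k,t_{k+1})$, $k\ge0$. Dynamics $$E\dot X(t)E^*=\mathcal F(\tau(t),X(t))\ (t\ne t_k),\quad EX(t_k^+)E^*=\mathcal J(X(t_k^-)),\quad EX(t_0)E^*=X_1^0\in\mathbb H^n_{\succeq0}.$$ $\mathcal F(\tau,\cdot),\mathcal J:\mathbb H^{n+m}\to\mathbb H^n$ are linear and bounded, $\mathcal F$ is continuous in $\tau$, both leave the positive semidefinite cone invariant (the state block stays positive semidefinite); adjoints: $\langle P,\mathcal F(\tau,X)\rangle=\langle\mathcal F^*(\tau,P),X\rangle$,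 $\langle P,\mathcal J(X)\rangle=\langle\mathcal J^*(P),X\rangle$. A trajectory is an $\mathbb H^{n+m}_{\succeq0}$-valued function satisfying these equations (regular enough that the limits and integrals involved make sense). A policy depending only on $X_1$ and $\tau$ is causal. Game. The flow weight $Z(\tau)$ and the jump weight $Z_{\mathrm{jp}}$ have the block structure $\begin{bmatrix}Q&S_u&S_w\\ S_u^*&R_u&R_{uw}\\ S_w^*&R_{uw}^*&-R_w\end{bmatrix}$ with $Q\succeq0$, $R_u\succ0$, $R_w\succ0$ and $\begin{bmatrix}Q&S_u\\ S_u^*&R_u\end{bmatrix}\succeq0$. For $T>0$, $J_T(X,X_1^0)=\int_{t_0}^{t_0+T}\langle Z(\tau(t)),X(t)\rangle dt+\sum_{t_k\in(t_0,t_0+T)}\langle Z_{\mathrm{jp}},X(t_k^-)\rangle$ (no terminal cost). The minimizer controls $(X_{12},X_{22})$, the maximizer $(X_{13},X_{23},X_{33})$, subject to $X(t)\succeq0$ and the dynamics; $J_T^\circ(X_1^0)=\min_{X_{12},X_{22}}\max_{X_{13},X_{23},X_{33}}J_T(X,X_1^0)$. HJI operators. $\mathcal I(\tau,P(\tau))=E^*\tfrac{dP}{d\tau}(\tau)E+\mathcal F^*(\tau,P(\tau))+Z(\tau)$, $\mathcal I^{\mathrm j}(P^+,P^-)=\mathcal J^*(P^+)-E^*P^-E+Z_{\mathrm{jp}}$. Any $\mathcal I\in\mathbb H^{n+m}$ is blocked as $\begin{bmatrix}\mathcal I_{11}&\mathcal I_{1u}&\mathcal I_{1w}\\ \mathcal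 I_{1u}^*&\mathcal I_{uu}&\mathcal I_{uw}\\ \mathcal I_{1w}^*&\mathcal I_{uw}^*&\mathcal I_{ww}\end{bmatrix}$, with Isaacs block $\mathcal G=\begin{bmatrix}\mathcal I_{uu}&\mathcal I_{uw}\\ \mathcal I_{uw}^*&\mathcal I_{ww}\end{bmatrix}$ and $\mathcal I_{1g}=[\mathcal I_{1u}\ \mathcal I_{1w}]$ (superscripts $\mathrm j$, $0$ denote the corresponding blocks of $\mathcal I^{\mathrm j}$, $\mathcal I^0$). Isaacs' condition for $\mathcal I$: $\mathcal I_{uu}\succeq0$, $\mathcal I_{ww}\preceq0$, $\mathcal I_{ww}-\mathcal I_{uw}^*\mathcal I_{uu}^\dagger\mathcal I_{uw}\preceq0$, $\mathcal I_{uu}-\mathcal I_{uw}\mathcal I_{ww}^\dagger\mathcal I_{uw}^*\succeq0$, $\operatorname{Im}\mathcal I_{uw}\subseteq\operatorname{Im}\mathcal I_{uu}$, $\operatorname{Im}\mathcal I_{uw}^*\subseteq\operatorname{Im}\mathcal I_{ww}$. Saddle-point policy. $(\mathcal K_u^s\times\mathcal K_w^s)(\tau,P(\tau))$ is the set of $(K_u,K_w)\in\mathbb C^{m_u\times n}\times\mathbb C^{m_w\times n}$ with $\mathcal G\begin{bmatrix}K_u\\ K_w\end{bmatrix}+\mathcal I_{1g}^*=0$; at jumps the policy uses gains from the analogous set defined with $\mathcal G^{\mathrm j},\mathcal I^{\mathrm j}_{1g}$ at $(P_s(0^+),P_s(T_{\min}))$. Playing these gains means $X=\begin{bmatrix}I\\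 K_u\\ K_w\end{bmatrix}X_1\begin{bmatrix}I\\ K_u\\ K_w\end{bmatrix}^*$. $P_s(0)$ denotes $P_s(0^+)$. *)

(* Defs.v *)
From mathcomp Require Import all_boot all_order all_algebra.
From mathcomp Require Import sesquilinear.
From mathcomp Require Import all_classical all_reals all_analysis.
From mathcomp Require Import complex.

Set Implicit Arguments.
Unset Strict Implicit.
Unset Printing Implicit Defensive.

Import Order.TTheory GRing.Theory Num.Theory.
Import numFieldNormedType.Exports.

Local Open Scope classical_set_scope.
Local Open Scope ring_scope.

Definition adjmx (R : realType) (p q : nat) (A : 'M[R[i]]_(p, q)) :
  'M[R[i]]_(q, p) := map_mx Num.conj A^T.

Notation "A ^H" := (adjmx A) (at level 8, format "A ^H") : ring_scope.

Definition psd (R : realType) (p : nat) (A : 'M[R[i]]_p) : Prop :=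
  A \is hermsymmx /\ forall v : 'cV[R[i]]_p, 0 <= (v^H *m A *m v) 0 0.

Definition pd (R : realType) (p : nat) (A : 'M[R[i]]_p) : Prop :=
  A \is hermsymmx /\
  forall v : 'cV[R[i]]_p, v != 0 -> 0 < (v^H *m A *m v) 0 0.

Definition nsd (R : realType) (p : nat) (A : 'M[R[i]]_p) : Prop := psd (- A).

Definition inner (R : realType) (p q : nat) (A B : 'M[R[i]]_(p, q)) : R[i] :=
  \tr (A *m B^H).

(** [inner] is real on Hermitian arguments; [rinner] is its value in [R]. *)
Definition rinner (R : realType) (p q : nat) (A B : 'M[R[i]]_(p, q)) : R :=
  complex.Re (inner A B).

Definition frob (R : realType) (p q : nat) (A : 'M[R[i]]_(p, q)) : R :=
  Num.sqrt (rinner A A).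

Definition penrose (R : realType) (p q : nat) (A : 'M[R[i]]_(p, q))
    (B : 'M[R[i]]_(q, p)) : Prop :=
  [/\ A *m B *m A = A, B *m A *m B = B,
      (A *m B)^H = A *m B & (B *m A)^H = B *m A].

(** The Moore-Penrose pseudoinverse, by its four defining equations, which
    have exactly one solution. *)
Definition mpinv (R : realType) (p q : nat) (A : 'M[R[i]]_(p, q)) :
  'M[R[i]]_(q, p) := xget 0 [set B | penrose A B].

(** Inclusion of column spaces ([<=%MS] compares row spaces). *)
Definition im_sub (R : realType) (p q r : nat) (A : 'M[R[i]]_(p, q))
    (B : 'M[R[i]]_(p, r)) : Prop := (A^T <= B^T)%MS.

(** A property of real functions is read on the real and imaginary parts of
    all the entries. *)

Definition entrywise (R : realType) (p q : nat) (Q : (R -> R) -> Prop)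
    (f : R -> 'M[R[i]]_(p, q)) : Prop :=
  forall i j, Q (fun s => complex.Re (f s i j)) /\
              Q (fun s => complex.Im (f s i j)).

Definition mx_continuous_on (R : realType) (p q : nat) (D : set R)
    (f : R -> 'M[R[i]]_(p, q)) : Prop :=
  entrywise (fun g : R -> R => {within D, continuous g}) f.

Definition mx_derivable (R : realType) (p q : nat)
    (f : R -> 'M[R[i]]_(p, q)) (s : R) : Prop :=
  entrywise (fun g : R -> R => derivable g s 1) f.

Definition mx_deriv (R : realType) (p q : nat) (f : R -> 'M[R[i]]_(p, q))
    (s : R) : 'M[R[i]]_(p, q) :=
  \matrix_(i, j) Complex (derive1 (fun r => complex.Re (f r i j)) s)
                         (derive1 (fun r => complex.Im (f r i j)) s).

Definition mx_measurable_on (R : realType) (p q : nat) (D : set R)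
    (f : R -> 'M[R[i]]_(p, q)) : Prop :=
  entrywise (fun g : R -> R => measurable_fun D g) f.

Definition real_integrable (R : realType) (D : set R) (g : R -> R) : Prop :=
  (@lebesgue_measure R).-integrable D (EFin \o g).

Definition mx_integrable (R : realType) (p q : nat) (D : set R)
    (f : R -> 'M[R[i]]_(p, q)) : Prop :=
  entrywise (real_integrable D) f.

Definition mx_int (R : realType) (p q : nat) (D : set R)
    (f : R -> 'M[R[i]]_(p, q)) : 'M[R[i]]_(p, q) :=
  \matrix_(i, j)
    Complex (Rintegral (@lebesgue_measure R) D (fun r => complex.Re (f r i j)))
            (Rintegral (@lebesgue_measure R) D (fun r => complex.Im (f r i j))).

Definition mx_left_limit (R : realType) (p q : nat)
    (f : R -> 'M[R[i]]_(p, q)) (s : R) (A : 'M[R[i]]_(p, q)) : Prop :=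
  forall i j,
    ((fun r => complex.Re (f r i j)) @ s^'- --> complex.Re (A i j)) /\
    ((fun r => complex.Im (f r i j)) @ s^'- --> complex.Im (A i j)).

(** Continuous on [[a, b]] and, off finitely many breakpoints, continuously
    differentiable, the derivative having finite one-sided limits everywhere. *)
Definition piecewise_C1 (R : realType) (a b : R) (g : R -> R) : Prop :=
  {within `[a, b], continuous g} /\
  exists breaks : seq R,
    [/\ forall s, a < s < b -> s \notin breaks ->
          derivable g s 1 /\ {for s, continuous (derive1 g)},
        forall s, a <= s < b -> exists l : R, derive1 g @ s^'+ --> l
      & forall s, a < s <= b -> exists l : R, derive1 g @ s^'- --> l].

Definition mx_piecewise_C1 (R : realType) (p q : nat) (a b : R)
    (f : R -> 'M[R[i]]_(p, q)) : Prop := entrywise (piecewise_C1 a b) f.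

Definition Emx (R : realType) (n m : nat) : 'M[R[i]]_(n, n + m) :=
  row_mx 1%:M 0.

Section Blocks.
Variables (R : realType) (n mu mw : nat).
Implicit Types M X : 'M[R[i]]_(n + (mu + mw)).

Definition state X : 'M[R[i]]_n := Emx R n (mu + mw) *m X *m (Emx R n (mu + mw))^H.

Definition X12 X : 'M[R[i]]_(mu, n) := usubmx (dlsubmx X).
Definition X22 X : 'M[R[i]]_mu := ulsubmx (drsubmx X).

Definition b11 M : 'M[R[i]]_n := ulsubmx M.
Definition b1g M : 'M[R[i]]_(n, mu + mw) := ursubmx M.
Definition b1u M : 'M[R[i]]_(n, mu) := lsubmx (b1g M).
Definition isaacs_block M : 'M[R[i]]_(mu + mw) := drsubmx M.
Definition buu M : 'M[R[i]]_mu := ulsubmx (isaacs_block M).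
Definition buw M : 'M[R[i]]_(mu, mw) := ursubmx (isaacs_block M).
Definition bww M : 'M[R[i]]_mw := drsubmx (isaacs_block M).

(** The lower right block of a weight is [- R_w]. *)
Definition game_weight M : Prop :=
  [/\ M \is hermsymmx,
      psd (b11 M),
      pd (buu M),
      pd (- bww M)
    & psd (block_mx (b11 M) (b1u M) (b1u M)^H (buu M))].

Definition isaacs M : Prop :=
  [/\ psd (buu M),
      nsd (bww M),
      nsd (bww M - (buw M)^H *m mpinv (buu M) *m buw M)
    & psd (buu M - buw M *m mpinv (bww M) *m (buw M)^H)] /\
  im_sub (buw M) (buu M) /\ im_sub (buw M)^H (bww M).

Definition schur M : 'M[R[i]]_n :=
  b11 M - b1g M *m mpinv (isaacs_block M) *m (b1g M)^H.

(** Does not involve the block [b11], hence not the derivative of [P] when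
    [M] is [HJI P tau]. *)
Definition saddle_gains M (Ku : 'M[R[i]]_(mu, n)) (Kw : 'M[R[i]]_(mw, n)) : Prop :=
  isaacs_block M *m col_mx Ku Kw + (b1g M)^H = 0.

(** The matrix in which both players play the gains [Ku], [Kw]. *)
Definition closed_loop (Ku : 'M[R[i]]_(mu, n)) (Kw : 'M[R[i]]_(mw, n))
    (X1 : 'M[R[i]]_n) : 'M[R[i]]_(n + (mu + mw)) :=
  col_mx 1%:M (col_mx Ku Kw) *m X1 *m (col_mx 1%:M (col_mx Ku Kw))^H.

End Blocks.

(** Linear maps between the real spaces of Hermitian matrices are represented by functions on all
    matrices, of which only the values at Hermitian matrices matter.
    Boundedness is automatic in finite dimension. *)

Definition herm_linear (R : realType) (p q : nat)
    (L : 'M[R[i]]_p -> 'M[R[i]]_q) : Prop :=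
  (forall X, X \is hermsymmx -> L X \is hermsymmx) /\
  (forall (a : R) X Y, X \is hermsymmx -> Y \is hermsymmx ->
     L (Complex a 0 *: X + Y) = Complex a 0 *: L X + L Y).

Definition is_adjoint (R : realType) (p q : nat)
    (L : 'M[R[i]]_p -> 'M[R[i]]_q) (Ladj : 'M[R[i]]_q -> 'M[R[i]]_p) : Prop :=
  (forall P, P \is hermsymmx -> Ladj P \is hermsymmx) /\
  (forall P X, P \is hermsymmx -> X \is hermsymmx ->
     inner P (L X) = inner (Ladj P) X).

(** The flow keeps the state block positive semidefinite: with inputs given
    by a gain and an additional positive semidefinite input covariance, i.e.
    [X = [I; K] Y [I; K]^H + diag (0, S)], a solution [Y] that starts in the
    cone stays in it. *)
Definition flow_cone_invariant (R : realType) (n m : nat)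
    (F : R -> 'M[R[i]]_(n + m) -> 'M[R[i]]_n) : Prop :=
  forall (a b : R) (K : R -> 'M[R[i]]_(m, n)) (S : R -> 'M[R[i]]_m)
         (Y : R -> 'M[R[i]]_n),
    0 <= a -> a <= b ->
    mx_continuous_on `[a, b] K -> mx_continuous_on `[a, b] S ->
    mx_continuous_on `[a, b] Y ->
    (forall s, a <= s <= b -> psd (S s)) ->
    (forall s, a <= s <= b -> Y s \is hermsymmx) ->
    (forall s, a < s < b ->
       mx_derivable Y s /\
       mx_deriv Y s = F s (col_mx 1%:M (K s) *m Y s *m (col_mx 1%:M (K s))^H
                           + block_mx 0 0 0 (S s))) ->
    psd (Y a) -> forall s, a <= s <= b -> psd (Y s).

Record game (R : realType) (n mu mw : nat) := Game {
  flow : R -> 'M[R[i]]_(n + (mu + mw)) -> 'M[R[i]]_n;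
  flow_adj : R -> 'M[R[i]]_n -> 'M[R[i]]_(n + (mu + mw));
  jump : 'M[R[i]]_(n + (mu + mw)) -> 'M[R[i]]_n;
  jump_adj : 'M[R[i]]_n -> 'M[R[i]]_(n + (mu + mw));
  flow_weight : R -> 'M[R[i]]_(n + (mu + mw));
  jump_weight : 'M[R[i]]_(n + (mu + mw)) }.

Section Game.
Variables (R : realType) (n mu mw : nat).
Local Notation matX := 'M[R[i]]_(n + (mu + mw)).
Local Notation mat1 := 'M[R[i]]_n.
Variable D : game R n mu mw.

Definition standing_assumptions : Prop :=
  (forall tau, 0 <= tau ->
     [/\ herm_linear (flow D tau), is_adjoint (flow D tau) (flow_adj D tau)
       & game_weight (flow_weight D tau)]) /\
  (forall X, X \is hermsymmx ->
     mx_continuous_on `[0, +oo[ (fun tau => flow D tau X)) /\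
  flow_cone_invariant (flow D) /\
  [/\ herm_linear (jump D), is_adjoint (jump D) (jump_adj D),
      game_weight (jump_weight D)
    & forall X, psd X -> psd (jump D X)].

(** [t 0] is the initial time, [t k] the [k]-th jump time. *)
Definition jump_times (t : nat -> R) : Prop :=
  (forall k, t k < t k.+1) /\ t @ \oo --> +oo.

Definition timer (t : nat -> R) (s : R) : R :=
  s - t (xget 0%N [set k | t k <= s < t k.+1]).

(** [xflow s] is [X(s)] for [s >= t 0].  [xjump k] is [X(t_k^-)] for [k >= 1]:
    its state block is the left limit of the state, whereas its control blocks
    are the decisions taken at the jump instant. *)
Record play := Play { xflow : R -> matX; xjump : nat -> matX }.

(** The flow equation is understood in the sense of Caratheodory, i.e. in
    integrated form between two jumps. *)
Definition trajectory (t : nat -> R) (X10 : mat1) (x : play) : Prop :=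
  [/\ forall s, t 0%N <= s -> psd (xflow x s),
      forall k, (0 < k)%N -> psd (xjump x k),
      forall b, t 0%N <= b ->
        mx_integrable `[t 0%N, b] (fun s => flow D (timer t s) (xflow x s)) /\
        real_integrable `[t 0%N, b]
          (fun s => rinner (flow_weight D (timer t s)) (xflow x s))
    & forall k s, t k <= s < t k.+1 ->
        state (xflow x s) = state (xflow x (t k)) +
          mx_int `[t k, s] (fun r => flow D (timer t r) (xflow x r))] /\
  [/\ state (xflow x (t 0%N)) = X10,
      forall k, (0 < k)%N ->
        mx_left_limit (fun s => state (xflow x s)) (t k) (state (xjump x k))
    & forall k, (0 < k)%N -> state (xflow x (t k)) = jump D (xjump x k)].

Definition cost (t : nat -> R) (T : R) (x : play) : R :=
  Rintegral (@lebesgue_measure R) `[t 0%N, t 0%N + T]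
    (fun s => rinner (flow_weight D (timer t s)) (xflow x s)) +
  \sum_(k \in [set k | t 0%N < t k < t 0%N + T])
    rinner (jump_weight D) (xjump x k).

(** A policy of the minimizer returns the pair [(X12, X22)] from the time (or
    the jump index) and the state. *)
Record policy := Policy {
  pflow : R -> mat1 -> 'M[R[i]]_(mu, n) * 'M[R[i]]_mu;
  pjump : nat -> mat1 -> 'M[R[i]]_(mu, n) * 'M[R[i]]_mu }.

Definition compatible (X1 : mat1) (c : 'M[R[i]]_(mu, n) * 'M[R[i]]_mu) : Prop :=
  psd (block_mx X1 c.1^H c.1 c.2).

(** Policies respecting the constraint [X >= 0], measurable in time and
    Lipschitz in the state with a locally integrable constant (the conditions
    under which closed-loop flow equations are solvable). *)
Definition admissible (t : nat -> R) (pi : policy) : Prop :=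
  [/\ forall s X1, t 0%N <= s -> psd X1 -> compatible X1 (pflow pi s X1),
      forall k X1, (0 < k)%N -> psd X1 -> compatible X1 (pjump pi k X1),
      forall X1, psd X1 ->
        mx_measurable_on `[t 0%N, +oo[ (fun s => (pflow pi s X1).1) /\
        mx_measurable_on `[t 0%N, +oo[ (fun s => (pflow pi s X1).2)
    & exists ell : R -> R,
        [/\ forall b, t 0%N <= b -> real_integrable `[t 0%N, b] ell,
            forall s X1 Y1, t 0%N <= s -> psd X1 -> psd Y1 ->
              frob ((pflow pi s X1).1 - (pflow pi s Y1).1) +
              frob ((pflow pi s X1).2 - (pflow pi s Y1).2)
                <= ell s * frob (X1 - Y1)
          & forall s, t 0%N <= s -> frob (pflow pi s 0).2 <= ell s]].

Definition follows (t : nat -> R) (pi : policy) (x : play) : Prop :=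
  (forall s, t 0%N <= s ->
     (X12 (xflow x s), X22 (xflow x s)) = pflow pi s (state (xflow x s))) /\
  (forall k, (0 < k)%N ->
     (X12 (xjump x k), X22 (xjump x k)) = pjump pi k (state (xjump x k))).

(** The blocks that [pi] leaves free, [(X13, X23, X33)], are the responses of
    the maximizer. *)
Definition worst_case_cost (t : nat -> R) (T : R) (X10 : mat1) (pi : policy) :
    \bar R :=
  ereal_sup [set (cost t T x)%:E | x in
    [set x | trajectory t X10 x /\ follows t pi x]].

Definition upper_value (t : nat -> R) (T : R) (X10 : mat1) : \bar R :=
  ereal_inf [set worst_case_cost t T X10 pi | pi in admissible t].

Definition HJI (P : R -> mat1) (tau : R) : matX :=
  (Emx R n (mu + mw))^H *m mx_deriv P tau *m Emx R n (mu + mw)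
  + flow_adj D tau (P tau) + flow_weight D tau.

Definition HJI_jump (Pplus Pminus : mat1) : matX :=
  jump_adj D Pplus - (Emx R n (mu + mw))^H *m Pminus *m Emx R n (mu + mw)
  + jump_weight D.

End Game.

(** The first argument of [cflow] is the timer, not the time. *)
Record causal_policy (R : realType) (n mu : nat) := CausalPolicy {
  cflow : R -> 'M[R[i]]_n -> 'M[R[i]]_(mu, n) * 'M[R[i]]_mu;
  cjump : 'M[R[i]]_n -> 'M[R[i]]_(mu, n) * 'M[R[i]]_mu }.

Definition run (R : realType) (n mu : nat) (t : nat -> R)
    (pi : causal_policy R n mu) : policy R n mu :=
  Policy (fun s => cflow pi (timer t s)) (fun _ => cjump pi).

Definition gain_policy (R : realType) (n mu : nat) (Tmin : R)
    (Ku : R -> 'M[R[i]]_(mu, n)) (Kju : 'M[R[i]]_(mu, n)) :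
    causal_policy R n mu :=
  CausalPolicy
    (fun tau X1 => let K := Ku (Num.min tau Tmin) in
                   (K *m X1, K *m X1 *m K^H))
    (fun X1 => (Kju *m X1, Kju *m X1 *m Kju^H)).

(** Both players play their gains, which are frozen at [tau = Tmin]. *)
Definition saddle_play (R : realType) (n mu mw : nat) (Tmin : R)
    (Ku : R -> 'M[R[i]]_(mu, n)) (Kw : R -> 'M[R[i]]_(mw, n))
    (Kju : 'M[R[i]]_(mu, n)) (Kjw : 'M[R[i]]_(mw, n))
    (t : nat -> R) (x : play R n mu mw) : Prop :=
  (forall s, t 0%N <= s ->
     let tau := Num.min (timer t s) Tmin in
     xflow x s = closed_loop (Ku tau) (Kw tau) (state (xflow x s))) /\
  (forall k, (0 < k)%N ->
     xjump x k = closed_loop Kju Kjw (state (xjump x k))).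

(** Square integrability is what makes [[I; K] X1 [I; K]^H] integrable along
    a bounded state. *)
Definition regular_gain (R : realType) (p q : nat) (Tmin : R)
    (K : R -> 'M[R[i]]_(p, q)) : Prop :=
  mx_measurable_on `[0, Tmin] K /\
  real_integrable `[0, Tmin] (fun tau => frob (K tau) ^+ 2).

(* Main.v *)
Require Import Defs.
From mathcomp Require Import all_boot all_order all_algebra.
From mathcomp Require Import sesquilinear spectral.
From mathcomp Require Import all_classical all_reals all_analysis.
From mathcomp Require Import measurable_realfun complex ring lra.

(** The certificate [Ps] makes [V = <Ps (min tau Tmin), X1>] a storage function
    for the game in which the minimizer plays the gains [Ku] and the maximizer
    answers freely.

    Along the flow, [d/dt V + <Z, X> = <I, X>], where [I] is the HJI matrix for
    [tau < Tmin] and the frozen matrix of the Geromel-Colaneri condition for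
    [tau > Tmin], because there the timer no longer moves [V].  At a jump the
    change of [V] plus the jump cost is [<I^j, X>].  In each case [<I, X> <= 0]
    by completing the square ([isaacs_dissipation]): factor [X = C C^H]; since
    the minimizer plays its gain, the [u]-rows of [C] are [Ku] times its
    [x]-rows, so the deviation from the saddle point lives in the [w]-rows only
    and
    [<I, X> = tr (x^H schur(I) x) + tr (v^H I_ww v)], [v = w - Kw x],
    where both terms are nonpositive.

    Integrating, [V] at the horizon plus the accumulated cost is at most
    [V = <Ps 0, X10>] at the initial time ([value_at_jump], by induction over
    the jumps), and [V >= 0] at the horizon because [Ps] and the state are
    positive semidefinite; as every dwell time is at least [Tmin], each jump
    indeed starts from [Ps Tmin] ([cost_bound]).

    The state is only an indefinite Lebesgue integral, so the product rule used
    in the integration is not the one of differential calculus: it is Fubini's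
    theorem on a triangle ([primitive_ibp]).  It applies to [Ps] because a
    piecewise C1 function is the integral of its derivative ([piecewise_ftc]),
    and the finitely many points where [Ps] is not derivable, at which nothing
    is known of the HJI matrix, do not affect the integral
    ([Rintegral_le0_off]).

    Finally the gain policy is admissible ([gain_policy_admissible]): it is
    linear in the state with Lipschitz constant [1 + 2 |Ku|^2], which is locally
    integrable since the gain is square integrable. *)

Set Implicit Arguments.
Unset Strict Implicit.
Unset Printing Implicit Defensive.

Import Order.TTheory GRing.Theory Num.Theory.
Import numFieldNormedType.Exports.
Local Open Scope classical_set_scope.
Local Open Scope ring_scope.

(** * Adjoints, positive semidefinite matrices and the trace pairing *)

Section Adjoint.
Variable R : realType.
Local Notation C := R[i].

Lemma adjmxK p q (A : 'M[C]_(p, q)) : A^H^H = A.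
Proof. by apply/matrixP => i j; rewrite !mxE conjCK. Qed.

Lemma adjmxD p q (A B : 'M[C]_(p, q)) : (A + B)^H = A^H + B^H.
Proof. by apply/matrixP => i j; rewrite !mxE rmorphD. Qed.

Lemma adjmxN p q (A : 'M[C]_(p, q)) : (- A)^H = - A^H.
Proof. by apply/matrixP => i j; rewrite !mxE rmorphN. Qed.

Lemma adjmx0 p q : (0 : 'M[C]_(p, q))^H = 0.
Proof. by apply/matrixP => i j; rewrite !mxE rmorph0. Qed.

Lemma adjmx1 p : (1%:M : 'M[C]_p)^H = 1%:M.
Proof. by rewrite /adjmx trmx1 map_mx1. Qed.

Lemma adjmxM p q r (A : 'M[C]_(p, q)) (B : 'M[C]_(q, r)) :
  (A *m B)^H = B^H *m A^H.
Proof. by rewrite /adjmx trmx_mul map_mxM. Qed.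

Lemma adj_row_mx p q r (A : 'M[C]_(p, q)) (B : 'M[C]_(p, r)) :
  (row_mx A B)^H = col_mx A^H B^H.
Proof. by rewrite /adjmx tr_row_mx map_col_mx. Qed.

Lemma adj_col_mx p q r (A : 'M[C]_(p, r)) (B : 'M[C]_(q, r)) :
  (col_mx A B)^H = row_mx A^H B^H.
Proof. by rewrite /adjmx tr_col_mx map_row_mx. Qed.

Lemma herm_adjP p (A : 'M[C]_p) : A \is hermsymmx <-> A^H = A.
Proof.
split=> [/is_hermitianmxP|hA]; first by rewrite expr0 scale1r => /esym.
by apply/is_hermitianmxP; rewrite expr0 scale1r -[LHS]hA.
Qed.

Lemma psd_herm p (A : 'M[C]_p) : psd A -> A^H = A.
Proof. by case=> /herm_adjP. Qed.

Lemma adj_delta p (i : 'I_p) :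
  (delta_mx i 0 : 'cV[C]_p)^H = delta_mx 0 i.
Proof.
apply/matrixP => k l; rewrite !mxE !ord1 andbT /=.
by case: (l == i); rewrite ?rmorph1 ?rmorph0.
Qed.

Lemma unitary_diagonalization p (A : 'M[C]_p) : A^H = A ->
  exists (U : 'M[C]_p) (d : 'rV[C]_p),
    [/\ U *m U^H = 1%:M, U^H *m U = 1%:M & A = U^H *m diag_mx d *m U].
Proof.
move=> /herm_adjP /hermitian_normalmx /orthomx_spectralP AE.
have U1 := unitarymxP (spectral_unitarymx A).
exists (spectralmx A), (spectral_diag A); split; [exact: U1|exact: mulmx1C U1|].
by rewrite [LHS]AE (invmx_unitary (spectral_unitarymx A)).
Qed.

(** Reduces a pairing [<M, X>] with a positive semidefinite [X] to the quadratic
    form of [M] on the columns of [B]. *)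
Lemma psd_gram p (A : 'M[C]_p) : psd A -> exists B : 'M[C]_p, A = B *m B^H.
Proof.
move=> pA; have [U [d [UU U'U AE]]] := unitary_diagonalization (psd_herm pA).
have d0 i : 0 <= d 0 i.
  have := (pA.2 (U^H *m delta_mx i 0)).
  rewrite adjmxM adjmxK AE !mulmxA -(mulmxA _ U) UU mulmx1.
  rewrite -(mulmxA _ U) UU mulmx1.
  by rewrite adj_delta -rowE -colE !mxE eqxx mulr1n.
pose r := map_mx (fun x : C => sqrtC x) d.
exists (U^H *m diag_mx r); rewrite adjmxM adjmxK AE.
have -> : (diag_mx r)^H = diag_mx r.
  rewrite /adjmx tr_diag_mx map_diag_mx; congr diag_mx.
  apply/matrixP => i j; rewrite !mxE ord1.
  by apply/CrealP/ger0_real; rewrite sqrtC_ge0.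
rewrite !mulmxA -(mulmxA _ (diag_mx _) (diag_mx _)) mulmx_diag.
congr (_ *m diag_mx _ *m _); apply/rowP => i; rewrite !mxE.
by rewrite -expr2 sqrtCK.
Qed.

Lemma psd_congr p q (A : 'M[C]_p) (B : 'M[C]_(p, q)) :
  psd A -> psd (B^H *m A *m B).
Proof.
move=> pA; split.
  by apply/herm_adjP; rewrite !adjmxM adjmxK (psd_herm pA) mulmxA.
by move=> v; have := pA.2 (B *m v); rewrite adjmxM !mulmxA.
Qed.

Lemma psd_trace_ge0 p (A : 'M[C]_p) : psd A -> 0 <= \tr A.
Proof.
move=> pA; apply: sumr_ge0 => i _.
have := pA.2 (delta_mx i 0).
by rewrite adj_delta -rowE -colE !mxE.
Qed.

Lemma gram_eq0 p q (A : 'M[C]_(p, q)) : A *m A^H = 0 -> A = 0.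
Proof.
move=> /matrixP AA0; apply/matrixP => i j; rewrite mxE; apply/eqP.
have := AA0 i i; rewrite !mxE => /eqP.
rewrite psumr_eq0 => [/allP /(_ j)|k _]; last by rewrite !mxE mul_conjC_ge0.
by rewrite mem_index_enum !mxE mul_conjC_eq0 => /(_ isT).
Qed.

(** [mpinv] is a choice among the solutions of the Penrose equations, so they
    hold once there is a solution: invert the nonzero eigenvalues, which are
    real, in a unitary diagonalization. *)
Lemma herm_mpinvP p (A : 'M[C]_p) : A^H = A -> penrose A (mpinv A).
Proof.
move=> /unitary_diagonalization [U [d [UU U'U AE]]].
suff [B pB] : exists B, penrose A B.
  by rewrite /mpinv; case: xgetP => [B' _ //|/(_ B)]; exact.
have dK (x y : 'rV[C]_p) :
    U^H *m diag_mx x *m U *m (U^H *m diag_mx y *m U) =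
    U^H *m diag_mx (\row_i (x 0 i * y 0 i)) *m U.
  rewrite !mulmxA -(mulmxA _ U U^H) UU mulmx1 -(mulmxA U^H (diag_mx x)).
  by rewrite mulmx_diag.
have diagH (x : 'rV[C]_p) : (forall i, x 0 i \is Num.real) ->
    (U^H *m diag_mx x *m U)^H = U^H *m diag_mx x *m U.
  move=> xr; rewrite !adjmxM adjmxK mulmxA; congr (_ *m _ *m _).
  rewrite /adjmx tr_diag_mx map_diag_mx; congr diag_mx.
  by apply/rowP => i; rewrite !mxE; apply/CrealP.
exists (U^H *m diag_mx (\row_i (d 0 i)^-1) *m U); rewrite AE.
split; rewrite !dK.
- congr (_ *m diag_mx _ *m _); apply/rowP => i; rewrite !mxE.
  by have [->|d0] := eqVneq (d 0 i) 0; rewrite ?mulr0 // divff ?mul1r.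
- congr (_ *m diag_mx _ *m _); apply/rowP => i; rewrite !mxE.
  by have [->|d0] := eqVneq (d 0 i) 0; rewrite ?mulr0 ?invr0 ?mul0r //
    mulVf ?mul1r.
- apply: diagH => i; rewrite !mxE.
  by have [->|d0] := eqVneq (d 0 i) 0; rewrite ?mul0r ?real0 // divff ?real1.
- apply: diagH => i; rewrite !mxE.
  by have [->|d0] := eqVneq (d 0 i) 0; rewrite ?mulr0 ?real0 // mulVf ?real1.
Qed.

Lemma rinnerE p q (A B : 'M[C]_(p, q)) :
  rinner A B = \sum_i \sum_j (complex.Re (A i j) * complex.Re (B i j)
                              + complex.Im (A i j) * complex.Im (B i j)).
Proof.
rewrite /rinner /inner /mxtrace raddf_sum; apply: eq_bigr => i _.
rewrite mxE raddf_sum; apply: eq_bigr => j _; rewrite !mxE.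
by case: (A i j) (B i j) => [a b] [c d] /=; rewrite mulrN opprK.
Qed.

Lemma rinnerDl p q (A B X : 'M[C]_(p, q)) :
  rinner (A + B) X = rinner A X + rinner B X.
Proof. by rewrite /rinner /inner mulmxDl mxtraceD raddfD. Qed.

Lemma rinnerNl p q (A X : 'M[C]_(p, q)) : rinner (- A) X = - rinner A X.
Proof. by rewrite /rinner /inner mulNmx raddfN raddfN. Qed.

Lemma rinner_congr p q (A : 'M[C]_p) (X : 'M[C]_q) (B : 'M[C]_(p, q)) :
  rinner (B^H *m A *m B) X = rinner A (B *m X *m B^H).
Proof.
rewrite /rinner /inner !adjmxM adjmxK -!mulmxA mxtrace_mulC.
by rewrite -!mulmxA.
Qed.

Lemma rinner_psd_ge0 p (A B : 'M[C]_p) : psd A -> psd B -> 0 <= rinner A B.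
Proof.
move=> pA /psd_gram [G ->]; rewrite /rinner /inner adjmxM adjmxK mulmxA mxtrace_mulC
        mulmxA.
by have := psd_trace_ge0 (psd_congr G pA); rewrite lecE => /andP[].
Qed.

End Adjoint.

(** * Completion of squares at a saddle point *)

Section Saddle.
Variables (R : realType) (n mu mw : nat).
Local Notation C := R[i].
Implicit Types M X : 'M[C]_(n + (mu + mw)).

Lemma stateE X : state X = ulsubmx X.
Proof.
rewrite /state /Emx adj_row_mx adjmx1 adjmx0 -[in LHS](submxK X).
by rewrite mul_row_block mul_row_col !mul1mx !mul0mx !addr0 mulmx1 mulmx0 addr0.
Qed.

Lemma state_gram p (A : 'M[C]_(n, p)) (B : 'M[C]_(mu, p)) (W : 'M[C]_(mw, p)) :
  let X := col_mx A (col_mx B W) *m (col_mx A (col_mx B W))^H in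
  [/\ state X = A *m A^H, X12 X = B *m A^H & X22 X = B *m B^H].
Proof.
rewrite /= stateE /X12 /X22 !adj_col_mx mul_col_row mul_col_mx mul_mx_row.
rewrite mul_col_row.
by rewrite block_mxKul block_mxKdl block_mxKdr block_mxKul col_mxKu.
Qed.

(** The saddle gains solve [G K = - I_1g^*], so [I_1g G^+ I_1g^*] is
    [K^* G G^+ G K = K^* G K]: the value of the Schur complement does not depend
    on which solution [K] is played. *)
Lemma saddle_completion M (Ku : 'M[C]_(mu, n)) (Kw : 'M[C]_(mw, n)) :
  (b1g M)^H = dlsubmx M -> (isaacs_block M)^H = isaacs_block M ->
  saddle_gains M Ku Kw ->
  schur M = b11 M - (col_mx Ku Kw)^H *m isaacs_block M *m col_mx Ku Kw.
Proof.
move=> hg hG /eqP; rewrite /saddle_gains addr_eq0 => /eqP sK.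
have {sK}gE : (b1g M)^H = - (isaacs_block M *m col_mx Ku Kw).
  by rewrite sK opprK.
rewrite /schur; congr (_ - _).
rewrite -[in LHS](adjmxK (b1g M)) gE !(adjmxN, adjmxM, adjmxK) hG.
rewrite !(mulNmx, mulmxN) opprK -!mulmxA; congr (_ *m _).
by rewrite !mulmxA; have [-> _ _ _] := herm_mpinvP hG.
Qed.

(** With [X = C C^H] and [x], [u], [w] the blocks of rows of [C], the gain relations
    for the [u]-player say that [u - Ku x] has zero Gram matrix, hence vanishes.
    Completing the square around [g = K x] leaves the Schur complement on [x]
    and the quadratic form of [G] on [g - K x], which has a [w]-component only
    and therefore sees just the block [bww M]. *)
Lemma isaacs_dissipation M X (Ku : 'M[C]_(mu, n)) (Kw : 'M[C]_(mw, n)) :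
  (b1g M)^H = dlsubmx M -> (isaacs_block M)^H = isaacs_block M ->
  nsd (bww M) -> nsd (schur M) -> saddle_gains M Ku Kw -> psd X ->
  X12 X = Ku *m state X -> X22 X = Ku *m state X *m Ku^H ->
  rinner M X <= 0.
Proof.
move=> hg hG Mww Ms sK /psd_gram [G XE] X12E X22E.
have GE := vsubmxK G; set A := usubmx G in GE.
have dE := vsubmxK (dsubmx G).
set B := usubmx _ in dE; set W := dsubmx _ in dE.
rewrite -dE in GE; rewrite -GE in XE.
have [s1 s2 s3] := state_gram A B W; rewrite -XE in s1 s2 s3.
(* [u - Ku x] vanishes because its Gram matrix does. *)
have BE : B = Ku *m A.
  apply/eqP; rewrite -subr_eq0; apply/eqP/gram_eq0.
  rewrite adjmxD adjmxN adjmxM mulmxDl !mulmxDr !mulNmx !mulmxN opprK.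
  have AB : A *m B^H = state X *m Ku^H.
    have := congr1 (@adjmx R _ _) s2; rewrite X12E s1 !adjmxM !adjmxK.
    by move=> <-.
  rewrite !mulmxA -s3 -s2 X22E X12E.
  rewrite -[Ku *m A *m A^H]mulmxA -[Ku *m A *m B^H]mulmxA -s1 AB mulmxA.
  by rewrite subrr add0r addNr.
pose V := W - Kw *m A; pose K := col_mx Ku Kw.
have gE : col_mx B W = K *m A + col_mx 0 V.
  by rewrite mul_col_mx add_col_mx addr0 -BE /V addrC subrK.
have gg : (b1g M)^H = - (isaacs_block M *m K).
  by apply/eqP; rewrite -addr_eq0 addrC; apply/eqP.
have g1 : b1g M = - (K^H *m isaacs_block M).
  by rewrite -[LHS]adjmxK gg adjmxN adjmxM hG.
have sE := saddle_completion hg hG sK; rewrite -/K in sE.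
have -> : rinner M X = complex.Re (\tr (A^H *m schur M *m A))
                     + complex.Re (\tr (V^H *m bww M *m V)).
  rewrite -raddfD -mxtraceD /rinner /inner XE adjmxM adjmxK mulmxA mxtrace_mulC mulmxA.
  congr (complex.Re (\tr _)).
  rewrite -[M in LHS]submxK gE adj_col_mx mul_row_block mul_row_col.
  rewrite -/(b11 M) -/(b1g M) -/(isaacs_block M) -hg gg g1 sE.
  have -> : V^H *m bww M *m V
          = (col_mx 0 V)^H *m isaacs_block M
            *m (col_mx 0 V : 'M[C]_(mu + mw, n + (mu + mw))).
    rewrite -[isaacs_block M]submxK -/(bww M) adj_col_mx mul_row_block mul_row_col.
    by rewrite adjmx0 !(mul0mx, mulmx0, add0r).
  rewrite adjmxD adjmxM !(mulmxDl, mulmxDr, mulmxN, mulNmx, mulmxA).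
  set a := A^H *m _ *m A; set b := _ *m isaacs_block M *m K *m A.
  set c := A^H *m _ *m _ *m _; set d := _ *m isaacs_block M *m K *m A.
  set e := _ *m isaacs_block M *m col_mx 0 V.
  move: a b c d e => a b c d e; apply/matrixP => i j; rewrite !mxE; ring.
have le0 p (N : 'M[C]_p) (Y : 'M[C]_(p, n + (mu + mw))) :
    nsd N -> complex.Re (\tr (Y^H *m N *m Y)) <= 0.
  move=> pN; have := psd_trace_ge0 (psd_congr Y pN).
  by rewrite mulmxN mulNmx raddfN oppr_ge0 lecE => /andP[].
by rewrite -[leRHS]addr0 lerD ?le0.
Qed.

End Saddle.

Section HJIBlocks.
Variables (R : realType) (n mu mw : nat).
Local Notation C := R[i].
Local Notation E := (Emx R n (mu + mw)).
Implicit Types N : 'M[C]_(n + (mu + mw)).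

Lemma Emx_congr (Q : 'M[C]_n) : E^H *m Q *m E = block_mx Q 0 0 0.
Proof.
rewrite /Emx adj_row_mx adjmx1 adjmx0 mul_col_mx mul_col_row.
by rewrite !(mul1mx, mul0mx, mulmx1, mulmx0).
Qed.

(** The derivative of [Ps] enters the HJI matrix in the state block only; neither
    the gains nor the Isaacs block see it. *)
Lemma Emx_congr_blocks (Q : 'M[C]_n) N :
  [/\ b1g (E^H *m Q *m E + N) = b1g N,
      dlsubmx (E^H *m Q *m E + N) = dlsubmx N &
      isaacs_block (E^H *m Q *m E + N) = isaacs_block N].
Proof.
rewrite Emx_congr -[N in _ + N]submxK add_block_mx !add0r.
by rewrite /b1g /isaacs_block block_mxKur block_mxKdl block_mxKdr.
Qed.

Lemma herm_blocks N : N^H = N ->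
  (b1g N)^H = dlsubmx N /\ (isaacs_block N)^H = isaacs_block N.
Proof.
move=> hN; rewrite /b1g /isaacs_block; split.
  by apply/matrixP => i j; rewrite -[in RHS]hN !mxE.
by apply/matrixP => i j; rewrite -[in RHS]hN !mxE.
Qed.

Lemma saddle_gains_ext N N' (Ku : 'M[C]_(mu, n)) (Kw : 'M[C]_(mw, n)) :
  b1g N = b1g N' -> isaacs_block N = isaacs_block N' ->
  saddle_gains N Ku Kw -> saddle_gains N' Ku Kw.
Proof. by rewrite /saddle_gains => -> ->. Qed.

(** The form in which completion of squares is applied: [Q] is [dPs/dtau] along the
    flow, [0] once the timer is frozen, and [- Ps Tmin] at a jump. *)
Lemma hji_dissipation (Q : 'M[C]_n) N (X : 'M[C]_(n + (mu + mw)))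
    (Ku : 'M[C]_(mu, n)) (Kw : 'M[C]_(mw, n)) :
  N^H = N -> isaacs (E^H *m Q *m E + N) -> nsd (schur (E^H *m Q *m E + N)) ->
  saddle_gains N Ku Kw -> psd X ->
  X12 X = Ku *m state X -> X22 X = Ku *m state X *m Ku^H ->
  rinner Q (state X) + rinner N X <= 0.
Proof.
move=> hN [[_ hww _ _] _] hs sK pX x12 x22.
have [e1 e2 e3] := Emx_congr_blocks Q N; have [h1 h2] := herm_blocks hN.
rewrite -[rinner Q _]rinner_congr -rinnerDl.
apply: (@isaacs_dissipation _ _ _ _ _ _ Ku Kw) => //.
- by rewrite e1 e2.
- by rewrite e3.
- by apply: saddle_gains_ext sK; rewrite ?e1 ?e3.
Qed.

Lemma psd0 p : psd (0 : 'M[C]_p).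
Proof.
split; first by apply/herm_adjP; rewrite adjmx0.
by move=> v; rewrite mulmx0 mul0mx mxE.
Qed.

Lemma rinner_adjoint p q (L : 'M[C]_p -> 'M[C]_q) Ladj P X :
  is_adjoint L Ladj -> P \is hermsymmx -> X \is hermsymmx ->
  rinner P (L X) = rinner (Ladj P) X.
Proof. by move=> [_ LE] hP hX; rewrite /rinner LE. Qed.

(** The adjoint is determined by the values of the map at Hermitian matrices: the
    difference [A] of two adjoints pairs to zero with itself.  Identifies
    [Finf_adj] with the adjoint of the flow at [Tmin]. *)
Lemma adjoint_unique p q (L L' : 'M[C]_p -> 'M[C]_q) Ladj Ladj' P :
  is_adjoint L Ladj -> is_adjoint L' Ladj' ->
  (forall X, X \is hermsymmx -> L X = L' X) -> P \is hermsymmx ->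
  Ladj P = Ladj' P.
Proof.
move=> [h1 a1] [h2 a2] LL hP; apply/eqP; rewrite -subr_eq0; apply/eqP.
set A := Ladj P - Ladj' P.
have hA : A^H = A.
  by rewrite adjmxD adjmxN; congr (_ - _); apply/herm_adjP; [exact: h1|exact: h2].
have hA' : A \is hermsymmx by apply/herm_adjP.
have A0 : inner A A = 0.
  rewrite /inner {1}/A mulmxBl raddfB /=.
  have := a1 P A hP hA'; have := a2 P A hP hA'.
  by rewrite LL // /inner => -> ->; rewrite subrr.
apply/matrixP => i j; rewrite mxE; apply/eqP.
move/eqP: A0; rewrite /inner /mxtrace psumr_eq0 => [/allP /(_ i)|k _]; last first.
  by rewrite mxE sumr_ge0 // => l _; rewrite !mxE mul_conjC_ge0.
rewrite mem_index_enum mxE => /(_ isT) /=.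
rewrite psumr_eq0 => [/allP /(_ j)|k _]; last by rewrite !mxE mul_conjC_ge0.
by rewrite mem_index_enum !mxE mul_conjC_eq0 => /(_ isT).
Qed.

End HJIBlocks.

(** * Product rule for indefinite Lebesgue integrals *)

Section RealIntegrals.
Variable R : realType.
Implicit Types (D : set R) (f g F G : R -> R) (a b c : R).
Local Notation mu := (@lebesgue_measure R).
Local Notation mble D := (measurable (D : set (measurableTypeR R))).
Local Notation "\int_( x 'in' D ) f" := (Rintegral mu D (fun x => f))
  (at level 36, f at level 36, x name, format "\int_( x  'in'  D )  f").

Lemma mitv (i : interval R) : mble [set` i].
Proof. exact: measurable_itv. Qed.

Lemma mfullT : mble [set: R].
Proof. exact: measurableT. Qed.

Lemma real_integrable_mkcond D f : mble D ->
  real_integrable D f <-> real_integrable setT (f \_ D).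
Proof.
move=> mD; rewrite /real_integrable -restrict_EFin.
exact: (@integrable_mkcond _ _ _ mu D (EFin \o f) mD).
Qed.

Lemma real_integrableD D f g : mble D ->
  real_integrable D f -> real_integrable D g ->
  real_integrable D (fun x => f x + g x).
Proof. by move=> mD fi gi; have := integrableD mD fi gi. Qed.

Lemma real_integrableZ D k f : mble D ->
  real_integrable D f -> real_integrable D (fun x => k * f x).
Proof. by move=> mD fi; have := integrableZl mD k fi. Qed.

Lemma real_integrable_sum (I : finType) D (h : I -> R -> R) : mble D ->
  (forall i, real_integrable D (h i)) ->
  real_integrable D (fun x => \sum_i h i x).
Proof.
move=> mD hi.
have := integrable_sum mD (index_enum I) (fun i _ => hi i).
move=> /(_ xpredT); rewrite /real_integrable; apply: (eq_integrable mD) => x _ /=.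
by rewrite sumEFin.
Qed.

Lemma Rintegral_sum (I : finType) D (h : I -> R -> R) : mble D ->
  (forall i, real_integrable D (h i)) ->
  \int_(x in D) (\sum_i h i x) = \sum_i \int_(x in D) h i x.
Proof.
move=> mD hi; rewrite /Rintegral.
under eq_integral do rewrite -sumEFin.
rewrite integral_sum // sum_fine // => i _.
by apply: integrable_fin_num => //; exact: hi.
Qed.

Lemma real_integrable_sub D D' f : mble D -> mble D' ->
  D' `<=` D -> real_integrable D f -> real_integrable D' f.
Proof. by move=> mD mD' sub; apply: integrableS. Qed.

Lemma eq_real_integrable D f g : mble D -> {in D, f =1 g} ->
  real_integrable D f -> real_integrable D g.
Proof.
by move=> mD fg; rewrite /real_integrable; apply: (eq_integrable mD) => x /fg /= ->.
Qed.

Lemma real_integrableM_continuous a b f g :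
  {within `[a, b], continuous g} -> real_integrable `[a, b] f ->
  real_integrable `[a, b] (fun x => g x * f x).
Proof.
move=> gc fi.
have cb : [bounded g x | x in `[a, b]].
  have /compact_bounded[M [_ gM]] := continuous_compact gc (@segment_compact _ a b).
  by exists M; split; rewrite ?num_real // => ? ? ? ?; exact: gM.
have mg : measurable_fun (`[a, b] : set (measurableTypeR R)) g.
  exact: subspace_continuous_measurable_fun.
have mD : mble `[a, b] by exact: measurable_itv.
by have := integrableMr mD mg cb fi.
Qed.

Lemma real_integrable_itv_cat a b c f : a <= b -> b <= c ->
  real_integrable `[a, b] f -> real_integrable `[b, c] f ->
  real_integrable `[a, c] f.
Proof.
move=> ab bc /(real_integrable_mkcond _ (mitv _)) i1 i2.
have /(real_integrable_mkcond _ (mitv _)) {}i2 : real_integrable `]b, c] f.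
  apply: real_integrable_sub i2; [exact: mitv|exact: mitv|].
  by apply: subset_itvr; rewrite bnd_simp.
apply/(real_integrable_mkcond _ (mitv _)).
apply: eq_real_integrable (real_integrableD mfullT i1 i2); first exact: mfullT.
move=> x _ /=; rewrite !patchE !mem_setE !in_itv /=.
rewrite -[point]/(0 : R).
have [xa|ax] := leP a x; have [xb|bx] := leP x b; rewrite /= ?add0r //.
- by rewrite (le_trans xb bc) addr0.
- by lra.
Qed.

Lemma Rintegral_itv_cat a b c f : a <= b -> b <= c ->
  real_integrable `[a, c] f ->
  \int_(x in `[a, c]) f x = \int_(x in `[a, b]) f x + \int_(x in `[b, c]) f x.
Proof.
move=> ab bc fi.
have := @Rintegral_itvB _ f (BLeft a) (BRight c) b fi.
rewrite !bnd_simp => /(_ ab bc) /eqP; rewrite subr_eq => /eqP ->.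
rewrite addrC; congr (_ + _); rewrite Rintegral_itv_obnd_cbnd //.
apply: real_integrable_sub fi => //.
by apply: subset_itvr; rewrite bnd_simp.
Qed.

Lemma below_diagonal_measurable :
  measurable [set p : measurableTypeR R * measurableTypeR R | p.2 <= p.1].
Proof.
have m2 : measurable_fun setT (snd : measurableTypeR R * measurableTypeR R -> R).
  exact: measurable_snd.
have m1 : measurable_fun setT (fst : measurableTypeR R * measurableTypeR R -> R).
  exact: measurable_fst.
have := measurable_fun_ler m2 m1.
move=> /(_ measurableT [set true] I); rewrite setTI.
congr measurable; apply/seteqP; split => p //=.
Qed.

(** The integrand whose two iterated integrals are [f] times a primitive of [g] and
    [g] times a primitive of [f] taken from the other end point. *)
Definition below_diagonal f g (p : R * R) : R :=
  f p.1 * g p.2 * \1_[set p : R * R | p.2 <= p.1] p.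

Lemma triangle_fubini f g :
  real_integrable setT f -> real_integrable setT g ->
  let H := below_diagonal f g in
  (\int[mu]_s \int[mu]_r (H (s, r))%:E = \int[mu]_r \int[mu]_s (H (s, r))%:E)%E.
Proof.
move=> fi gi H.
pose T := (measurableTypeR R * measurableTypeR R)%type.
have mf : measurable_fun setT (f : measurableTypeR R -> R).
  by apply/measurable_EFinP; exact: measurable_int fi.
have mg : measurable_fun setT (g : measurableTypeR R -> R).
  by apply/measurable_EFinP; exact: measurable_int gi.
have mH : measurable_fun setT (EFin \o H : T -> \bar R).
  apply/measurable_EFinP/measurable_funM.
    apply: measurable_funM; apply: measurableT_comp => //.
  by apply: measurable_indic; exact: below_diagonal_measurable.
pose K (p : T) := f p.1 * g p.2.
have mK : measurable_fun setT K by apply: measurable_funM; exact: measurableT_comp.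
have nf : measurable_fun setT (fun x => `|f x|%:E : \bar R).
  by apply/measurable_EFinP; exact: measurableT_comp.
have ng : measurable_fun setT (fun x => `|g x|%:E : \bar R).
  by apply/measurable_EFinP; exact: measurableT_comp.
have iK : (mu \x mu)%E.-integrable setT (EFin \o K).
  apply/(integrable12ltyP mu mu); first exact/measurable_EFinP.
  have [_ fi'] := integrableP _ _ _ fi; have [_ gi'] := integrableP _ _ _ gi.
  have -> : (\int[mu]_x \int[mu]_y `|(EFin \o K) (x, y)| =
             \int[mu]_x (`|f x|%:E * \int[mu]_y `|g y|%:E))%E.
    apply: eq_integral => x _; rewrite -ge0_integralZl //.
    by apply: eq_integral => y _; rewrite /= normrM EFinM.
  rewrite ge0_integralZr //; last exact: integral_ge0.
  by rewrite lte_mul_pinfty ?integral_ge0 // ge0_fin_numE ?integral_ge0.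
have iH : (mu \x mu)%E.-integrable setT (EFin \o H : T -> \bar R).
  apply: le_integrable iK => // p _; rewrite /H /below_diagonal /= lee_fin.
  rewrite !normrM ler_piMr ?mulr_ge0 //.
  by rewrite indicE; case: (_ \in _); rewrite ?normr1 ?normr0.
exact: (Fubini iH).
Qed.

Lemma below_diagonal_restrict a b f g s r :
  below_diagonal (f \_ `[a, b]) (g \_ `[a, b]) (s, r) =
  if (a <= r <= b) && (r <= s <= b) then f s * g r else 0.
Proof.
rewrite /below_diagonal /= !patchE !mem_setE indicE !in_itv /=.
rewrite -[point]/(0 : R).
have -> : ((s, r) \in [set p : R * R | p.2 <= p.1]) = (r <= s).
  by apply/idP/idP; rewrite inE.
have [rs|rs] := leP r s; last by rewrite mulr0 andbF.
rewrite mulr1 /=.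
have [ar|ar] := leP a r; last by rewrite mulr0.
have [rb|rb] := leP r b; last by rewrite mulr0.
by rewrite (le_trans ar rs) /=; case: ifP; rewrite ?mul0r.
Qed.

Lemma triangle_swap a b f g :
  real_integrable `[a, b] f -> real_integrable `[a, b] g ->
  \int_(s in `[a, b]) (f s * \int_(r in `[a, s]) g r) =
  \int_(r in `[a, b]) (g r * \int_(s in `[r, b]) f s).
Proof.
move=> fi gi.
have fi1 := fi; have gi1 := gi.
move/(real_integrable_mkcond _ (mitv _)) : fi1 => fi1.
move/(real_integrable_mkcond _ (mitv _)) : gi1 => gi1.
have := triangle_fubini fi1 gi1; set H := below_diagonal _ _ => E.
rewrite [LHS]Rintegral_mkcond [RHS]Rintegral_mkcond; congr fine.
transitivity (\int[mu]_s \int[mu]_r (H (s, r))%:E)%E; last first.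
  rewrite E {E}; apply: eq_integral => r _.
  rewrite patchE mem_setE in_itv /=.
  have [/andP[ar rb]|rab] := boolP (a <= r <= b); last first.
    by rewrite integral0_eq // => s _; rewrite /H below_diagonal_restrict (negbTE rab).
  have irb : real_integrable `[r, b] f.
    apply: real_integrable_sub fi; [exact: mitv|exact: mitv|].
    by apply: subset_itvr; rewrite bnd_simp.
  rewrite EFinM fineK; last exact: integrable_fin_num irb.
  rewrite -integralZl // [RHS]integral_mkcond; apply: eq_integral => s _.
  rewrite /H below_diagonal_restrict ar rb /= patchE mem_setE in_itv /=.
  by case: ifP => // _; rewrite mulrC EFinM.
apply: eq_integral => s _; rewrite patchE mem_setE in_itv /= {E}.
have [/andP[as_ sb]|sab] := boolP (a <= s <= b); last first.
  rewrite integral0_eq // => r _; rewrite /H below_diagonal_restrict.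
  by case: ifP => // /andP[/andP[ar _] /andP[rs sb]]; rewrite (le_trans ar rs) sb in sab.
have ias : real_integrable `[a, s] g.
  apply: real_integrable_sub gi; [exact: mitv|exact: mitv|].
  by apply: subset_itvl; rewrite bnd_simp.
rewrite EFinM fineK; last exact: integrable_fin_num ias.
rewrite -integralZl // [LHS]integral_mkcond; apply: eq_integral => r _.
rewrite /H below_diagonal_restrict sb andbT patchE mem_setE in_itv /=.
have [ar|//] := leP a r; have [rs|rs] := leP r s; last by rewrite /= andbF.
by rewrite (le_trans rs sb) EFinM.
Qed.

Lemma real_integrableB D f g : mble D ->
  real_integrable D f -> real_integrable D g ->
  real_integrable D (fun x => f x - g x).
Proof. by move=> mD fi gi; have := integrableB mD fi gi. Qed.

(** Absolute continuity in integrated form, which is how the flow equation of a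
    trajectory is stated. *)
Definition primitive a b F f :=
  real_integrable `[a, b] f /\
  forall s, a <= s <= b -> F s = F a + \int_(r in `[a, s]) f r.

Lemma primitive_continuous a b F f : a <= b -> primitive a b F f ->
  {within `[a, b], continuous F}.
Proof.
move=> ab [fi FE].
have := parameterized_integral_continuous ab fi.
rewrite /parameterized_integral => cont.
have c2 : {within `[a, b], continuous (fun s => F a + \int_(r in `[a, s]) f r)}.
  by move=> s; apply: cvgD; [exact: cvg_cst|exact: cont].
apply: subspace_eq_continuous c2 => s.
by rewrite inE /= in_itv /= => /FE.
Qed.

Lemma primitive_sub a b c d F f : primitive a b F f -> a <= c -> c <= d -> d <= b ->
  primitive c d F f.
Proof.
move=> [fi FE] ac cd db; split.
  by apply: real_integrable_sub fi; [exact: mitv|exact: mitv|];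
    apply: subset_itv; rewrite bnd_simp.
move=> s /andP[cs sd]; rewrite (FE c) ?ac ?(le_trans cd db) //.
rewrite (FE s) ?(le_trans ac cs) ?(le_trans sd db) // (Rintegral_itv_cat ac cs) ?addrA //.
by apply: real_integrable_sub fi; [exact: mitv|exact: mitv|];
  apply: subset_itv; rewrite bnd_simp // (le_trans sd db).
Qed.

Lemma primitive_cat a b c F f : a <= b -> b <= c ->
  primitive a b F f -> primitive b c F f -> primitive a c F f.
Proof.
move=> ab bc [fi1 FE1] [fi2 FE2].
have fi := real_integrable_itv_cat ab bc fi1 fi2.
split=> // s /andP[as_ sc]; have [sb|bs] := leP s b; first by rewrite FE1 ?as_.
rewrite FE2 ?(ltW bs) // FE1 ?ab ?lexx // (Rintegral_itv_cat ab (ltW bs)) ?addrA //.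
by apply: real_integrable_sub fi; [exact: mitv|exact: mitv|];
  apply: subset_itv; rewrite bnd_simp.
Qed.

(** For merely integrable [f] and [g] this is Fubini on the triangle [r <= s],
    after the constants [F a] and [G a] are split off. *)
Lemma primitive_ibp a b F f G g : a <= b ->
  primitive a b F f -> primitive a b G g ->
  real_integrable `[a, b] (fun s => f s * G s + F s * g s) /\
  F b * G b - F a * G a = \int_(s in `[a, b]) (f s * G s + F s * g s).
Proof.
move=> ab pF pG.
have cF := primitive_continuous ab pF; have cG := primitive_continuous ab pG.
have [fi FE] := pF; have [gi GE] := pG.
have iFg := real_integrableM_continuous cF gi.
have iGf := real_integrableM_continuous cG fi.
have ifG : real_integrable `[a, b] (fun s => f s * G s).
  by apply: eq_real_integrable iGf => [|s _]; [exact: mitv|rewrite mulrC].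
split; first by apply: real_integrableD => //; exact: mitv.
rewrite RintegralD //.
have E1 : \int_(s in `[a, b]) (f s * G s) =
   \int_(s in `[a, b]) (f s * \int_(r in `[a, s]) g r) + G a * (F b - F a).
  transitivity (\int_(s in `[a, b]) (f s * G s - G a * f s + G a * f s)).
    by apply: eq_Rintegral => s _; rewrite subrK.
  have iGa : real_integrable `[a, b] (fun s => G a * f s).
    by apply: real_integrableZ => //; exact: mitv.
  rewrite RintegralD //; last by apply: real_integrableB => //; exact: mitv.
  rewrite RintegralZl //.
  congr (_ + _ * _).
    apply: eq_Rintegral => s; rewrite inE /= in_itv /= => sab.
    by rewrite (GE s) //; ring.
  by rewrite (FE b) ?ab ?lexx //; ring.
have E2 : \int_(s in `[a, b]) (F s * g s) =
   F b * (G b - G a) - \int_(r in `[a, b]) (g r * \int_(s in `[r, b]) f s).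
  have iFbg : real_integrable `[a, b] (fun s => F b * g s).
    by apply: real_integrableZ => //; exact: mitv.
  rewrite [G b]GE ?ab ?lexx // [G a + _]addrC addrK.
  transitivity (\int_(s in `[a, b]) (F b * g s - (F b * g s - F s * g s))).
    by apply: eq_Rintegral => s _; rewrite opprB addrC subrK.
  have iB : real_integrable `[a, b] (fun s => F b * g s - F s * g s).
    by apply: real_integrableB => //; exact: mitv.
  rewrite RintegralB // RintegralZl //.
  congr (_ - _).
  apply: eq_Rintegral => r; rewrite inE /= in_itv /= => /andP[ar rb].
  have := FE b; rewrite ab lexx (Rintegral_itv_cat ar rb) // => /(_ isT) ->.
  by rewrite (FE r) ?ar //; ring.
by rewrite E1 E2 (triangle_swap fi gi); ring.
Qed.

(** * Piecewise smooth functions, translation and freezing *)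

(** At break points a derivative takes arbitrary values, so integrals are compared
    on open intervals. *)
Lemma Rintegral_interior a b f g : {in `]a, b[, f =1 g} ->
  real_integrable `[a, b] f ->
  real_integrable `[a, b] g /\
  \int_(x in `[a, b]) f x = \int_(x in `[a, b]) g x.
Proof.
move=> fg fi.
have mf : measurable_fun `]a, b[ f.
  have /measurable_EFinP : measurable_fun (`[a, b] : set (measurableTypeR R)) (EFin \o f).
    exact: measurable_int fi.
  apply: measurable_funS => //.
  exact: subset_itv_oo_cc.
have mg : measurable_fun `]a, b[ g.
  by apply: eq_measurable_fun mf => x; rewrite mem_setE => /fg ->.
split; last first.
  rewrite /Rintegral; congr fine; apply: eq_integral_itv_bounded => //.
have mgc : measurable_fun `[a, b] g by apply: measurable_fun_itv_cc mg.
apply/integrableP; split; first exact/measurable_EFinP.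
have [_] := integrableP _ _ _ fi; congr (_ < _)%E.
apply: (@eq_integral_itv_bounded R a b (fun x => `|g x|) (fun x => `|f x|) true false) => //.
- exact: measurableT_comp.
- exact: measurableT_comp.
- by move=> x /fg /= ->.
Qed.

(** One-sided limits at the end points extend the derivative to a continuous
    function on the closed interval, to which the fundamental theorem applies. *)
Lemma ftc_interior a b g : a < b -> {within `[a, b], continuous g} ->
  (forall s, a < s < b -> derivable g s 1 /\ {for s, continuous (derive1 g)}) ->
  (exists l : R, derive1 g @ a^'+ --> l) ->
  (exists l : R, derive1 g @ b^'- --> l) ->
  primitive a b g (derive1 g).
Proof.
move=> ab cg dg [la cla] [lb clb].
pose h s := if s <= a then la else if s < b then derive1 g s else lb.
have hE : {in `]a, b[, derive1 g =1 h}.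
  by move=> s; rewrite in_itv /h /= => /andP[as_ ->]; rewrite leNgt as_.
have ch : {within `[a, b], continuous h}.
  apply/(continuous_within_itvP _ ab); split.
  - move=> s /[!in_itv] /= /andP[as_ sb]; have sab : a < s < b by rewrite as_.
    have [_ cs] := dg s sab.
    rewrite /continuous_at -(hE s) ?in_itv /= ?as_ //.
    apply: cvg_trans cs; apply: near_eq_cvg; near=> x; apply: hE.
    rewrite in_itv /=; apply/andP; split; near: x.
      exact: lt_nbhsr.
    exact: lt_nbhsl.
  - rewrite {2}/h lexx; apply: cvg_trans cla; apply: near_eq_cvg.
    near=> x; apply: hE; rewrite in_itv /=; apply/andP; split; near: x.
      exact: nbhs_right_gt.
    exact: nbhs_right_lt.
  - rewrite {2}/h leNgt ab ltxx /=; apply: cvg_trans clb; apply: near_eq_cvg.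
    near=> x; apply: hE; rewrite in_itv /=; apply/andP; split; near: x.
      exact: nbhs_left_gt.
    exact: nbhs_left_lt.
have ih : real_integrable `[a, b] h.
  by apply: continuous_compact_integrable => //; exact: segment_compact.
split.
  by have [] := Rintegral_interior (fun x xab => esym (hE x xab)) ih.
move=> s /andP[]; rewrite le_eqVlt => /predU1P[<- _|as_ sb].
  by rewrite set_itv1 Rintegral_set1 addr0.
have ih' : real_integrable `[a, s] h.
  apply: real_integrable_sub ih; [exact: mitv|exact: mitv|].
  by apply: subset_itvl; rewrite bnd_simp.
have hE' : {in `]a, s[, h =1 derive1 g}.
  move=> x; rewrite in_itv /= => /andP[ax xs]; rewrite hE // in_itv /= ax.
  exact: lt_le_trans sb.
have [_ <-] := Rintegral_interior hE' ih'.
have sub : `[a, s] `<=` `[a, b].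
  by apply: subset_itvl; rewrite bnd_simp.
rewrite /Rintegral (@continuous_FTC2 _ h g a s) //.
- by rewrite addrC subrK.
- exact: continuous_subspaceW ch.
- have /(continuous_within_itvP _ as_) [_ ca cs] : {within `[a, s], continuous g}.
    exact: continuous_subspaceW cg.
  split=> // x /[!in_itv] /= /andP[ax xs].
  have xab : a < x < b by rewrite ax (lt_le_trans xs).
  exact: (dg x xab).1.
- by move=> x xas; rewrite hE'.
Unshelve. all: by end_near. Qed.

(** Induction over the break points: split the interval at the first one that lies
    inside it. *)
Lemma piecewise_ftc a b g : a < b -> piecewise_C1 a b g ->
  primitive a b g (derive1 g).
Proof.
move=> + [+ [breaks []]]; elim: breaks a b => [|c l IHl] a b ab cg dg rg lg.
  apply: ftc_interior => //.
  - by move=> s sab; exact: dg.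
  - by apply: rg; rewrite lexx.
  - by apply: lg; rewrite lexx andbT.
have [/andP[ac cb]|cab] := boolP (a < c < b); last first.
  apply: IHl => // s sab sl; apply: dg => //; rewrite inE negb_or sl andbT.
  by apply: contraNneq cab => <-.
apply: (primitive_cat (ltW ac) (ltW cb)).
- apply: IHl => //.
  + by apply: continuous_subspaceW cg; apply: subset_itvl; rewrite bnd_simp ltW.
  + move=> s /andP[as_ sc] sl; apply: dg; first by rewrite as_ (lt_trans sc).
    by rewrite inE negb_or sl lt_eqF.
  + by move=> s /andP[as_ sc]; apply: rg; rewrite as_ (lt_trans sc).
  + by move=> s /andP[as_ sc]; apply: lg; rewrite as_ (le_trans sc) // ltW.
- apply: IHl => //.
  + by apply: continuous_subspaceW cg; apply: subset_itvr; rewrite bnd_simp ltW.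
  + move=> s /andP[cs sb] sl; apply: dg; first by rewrite sb (lt_trans ac).
    by rewrite inE negb_or sl gt_eqF.
  + by move=> s /andP[cs sb]; apply: rg; rewrite sb (le_trans (ltW ac)).
  + by move=> s /andP[cs sb]; apply: lg; rewrite sb (lt_trans ac).
Qed.

(** Translation invariance, via uniqueness of Lebesgue measure; it carries
    functions of the timer over to functions of time. *)
Let shift c : measurableTypeR R -> measurableTypeR R := fun x => x - c.

Let shift_measurable c : measurable_fun setT (shift c).
Proof. by apply: measurable_funB. Qed.

Lemma lebesgue_measure_shift c (A : set (measurableTypeR R)) : measurable A ->
  mu A = pushforward mu (shift c) A.
Proof.
move=> mA.
pose nu : measure (measurableTypeR R) R :=
  measure_function_pushforward__canonical__measure_function_Measure mu (shift_measurable c).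
apply: (@lebesgue_measure_unique R nu _ A mA) => _ [[x y] _ <-] /=.
rewrite /pushforward.
have -> : shift c @^-1` `]x, y] = `]x + c, y + c]%classic.
  by apply/seteqP; split=> z /=; rewrite !in_itv /= /shift ltrBrDr lerBlDr.
rewrite !lebesgue_measure_itv /= !lte_fin ltrD2r.
by case: ifP => // _; rewrite -!EFinB; congr EFin; ring.
Qed.

Lemma Rintegral_shift a b c f : real_integrable `[a, b] f ->
  real_integrable `[a + c, b + c] (fun x => f (x - c)) /\
  \int_(x in `[a + c, b + c]) f (x - c) = \int_(x in `[a, b]) f x.
Proof.
move=> /(real_integrable_mkcond _ (mitv _)) fi.
pose f1 : measurableTypeR R -> R := f \_ `[a, b].
pose nu : measure (measurableTypeR R) R :=
  measure_function_pushforward__canonical__measure_function_Measure mu (shift_measurable c).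
have nuE (h : measurableTypeR R -> \bar R) : (\int[nu]_x h x = \int[mu]_x h x)%E.
  by apply: eq_measure_integral => A mA _; exact: (esym (lebesgue_measure_shift c mA)).
have mf1 : measurable_fun setT (EFin \o f1) by exact: measurable_int fi.
have fE x : f1 (x - c) = ((fun x => f (x - c)) \_ `[a + c, b + c]) x.
  by rewrite /f1 !patchE !mem_setE !in_itv /= lerBrDr lerBlDr.
have fi' : real_integrable setT (fun x => f1 (x - c)).
  apply/integrableP; split.
    by apply: (measurableT_comp mf1); exact: shift_measurable.
  have [_] := integrableP _ _ _ fi; congr (_ < _)%E.
  rewrite -nuE (ge0_integral_pushforward (shift_measurable c)) //.
  exact: measurableT_comp.
split.
  apply/(real_integrable_mkcond _ (mitv _)).
  by apply: eq_real_integrable fi' => // x _; exact: fE.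
rewrite [LHS]Rintegral_mkcond [RHS]Rintegral_mkcond; congr fine.
rewrite -[RHS]nuE (integral_pushforward (shift_measurable c)) //.
by apply: eq_integral => x _; congr EFin; exact: (esym (fE x)).
Qed.

Lemma primitive_shift a b c F f : primitive a b F f ->
  primitive (a + c) (b + c) (fun s => F (s - c)) (fun s => f (s - c)).
Proof.
move=> [fi FE]; split; first by have [] := Rintegral_shift c fi.
move=> s /andP[as_ sb].
have abs : a <= s - c <= b by rewrite lerBrDr as_ lerBlDr.
rewrite FE // addrK; congr (_ + _).
have fi' : real_integrable `[a, s - c] f.
  apply: real_integrable_sub fi; [exact: mitv|exact: mitv|].
  by apply: subset_itvl; rewrite bnd_simp lerBlDr.
by have [_] := Rintegral_shift c fi'; rewrite subrK => ->.
Qed.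

(** Freezing the argument at [T] freezes the derivative to [0]. *)
Lemma primitive_min T b F f : 0 <= T -> 0 <= b -> primitive 0 T F f ->
  primitive 0 b (fun s => F (Num.min s T)) (fun s => if s < T then f s else 0).
Proof.
move=> T0 b0 pF.
have [fi FE] := pF.
have p1 c : 0 <= c -> c <= T ->
    primitive 0 c (fun s => F (Num.min s T)) (fun s => if s < T then f s else 0).
  move=> c0 cT; have [fic FEc] := primitive_sub pF (lexx 0) c0 cT.
  have fE s : s <= c -> {in `]0, s[, f =1 (fun s => if s < T then f s else 0)}.
    move=> sc x; rewrite in_itv /= => /andP[_ xs].
    by rewrite ifT // (lt_le_trans xs) // (le_trans sc).
  split; first by have [] := Rintegral_interior (fE c (lexx c)) fic.
  move=> s /andP[s0 sc]; rewrite min_l ?(le_trans sc) // min_l // FEc ?s0 //.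
  congr (_ + _).
  have fis : real_integrable `[0, s] f.
    apply: real_integrable_sub fic; [exact: mitv|exact: mitv|].
    by apply: subset_itvl; rewrite bnd_simp.
  by have [_ ->] := Rintegral_interior (fE s sc) fis.
have [bT|Tb] := leP b T; first exact: p1.
apply: (primitive_cat T0 (ltW Tb)); first exact: p1.
have E s : {in `[T, s]%classic, (fun=> 0 : R) =1 (fun s => if s < T then f s else 0)}.
  by move=> x; rewrite mem_setE in_itv /= => /andP[Tx _]; rewrite ltNge Tx.
split.
  apply: eq_real_integrable (E b) _; first exact: mitv.
  apply: continuous_compact_integrable; first exact: segment_compact.
  by move=> ?; exact: cvg_cst.
move=> s /andP[Ts sb]; rewrite min_r // minxx.
have <- := @eq_Rintegral _ _ _ mu _ _ _ (E s).
by rewrite Rintegral_cst // mul0r addr0.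
Qed.

End RealIntegrals.

(** * Matrix-valued integrals *)

Section MatrixCalculus.
Variables (R : realType).
Local Notation C := R[i].
Local Notation mu := (@lebesgue_measure R).

Definition mx_primitive (a b : R) p q (F f : R -> 'M[C]_(p, q)) :=
  forall i j,
    primitive a b (fun s => complex.Re (F s i j)) (fun s => complex.Re (f s i j)) /\
    primitive a b (fun s => complex.Im (F s i j)) (fun s => complex.Im (f s i j)).

Lemma mx_primitive_ibp (a b : R) p q (P P' Y Y' : R -> 'M[C]_(p, q)) :
  a <= b -> mx_primitive a b P P' -> mx_primitive a b Y Y' ->
  real_integrable `[a, b] (fun s => rinner (P' s) (Y s) + rinner (P s) (Y' s)) /\
  rinner (P b) (Y b) - rinner (P a) (Y a) =
  Rintegral mu `[a, b] (fun s => rinner (P' s) (Y s) + rinner (P s) (Y' s)).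
Proof.
move=> ab pP pY.
pose hr i j s := complex.Re (P' s i j) * complex.Re (Y s i j)
               + complex.Re (P s i j) * complex.Re (Y' s i j).
pose hi i j s := complex.Im (P' s i j) * complex.Im (Y s i j)
               + complex.Im (P s i j) * complex.Im (Y' s i j).
have hE : (fun s => rinner (P' s) (Y s) + rinner (P s) (Y' s)) =
          (fun s => \sum_i \sum_j (hr i j s + hi i j s)).
  apply/funext => s; rewrite !rinnerE -big_split; apply: eq_bigr => i _ /=.
  by rewrite -big_split; apply: eq_bigr => j _ /=; rewrite /hr /hi; ring.
have ibr i j := primitive_ibp ab (pP i j).1 (pY i j).1.
have ibi i j := primitive_ibp ab (pP i j).2 (pY i j).2.
have ih i j : real_integrable `[a, b] (fun s => hr i j s + hi i j s).
  by apply: real_integrableD; [exact: mitv|exact: (ibr i j).1|exact: (ibi i j).1].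
have ihs i : real_integrable `[a, b] (fun s => \sum_j (hr i j s + hi i j s)).
  exact: real_integrable_sum (mitv _) (ih i).
rewrite hE; split; first exact: real_integrable_sum (mitv _) ihs.
rewrite (Rintegral_sum (mitv _) ihs).
rewrite !rinnerE -sumrB; apply: eq_bigr => i _.
rewrite (Rintegral_sum (mitv _) (ih i)).
rewrite -sumrB; apply: eq_bigr => j _.
rewrite RintegralD //; [|exact: (ibr i j).1|exact: (ibi i j).1].
by rewrite -(ibr i j).2 -(ibi i j).2; ring.
Qed.

Lemma Rintegral_le0_off (a b : R) (h : R -> R) (N : seq R) :
  real_integrable `[a, b] h ->
  (forall s, a <= s <= b -> s \notin N -> h s <= 0) ->
  Rintegral mu `[a, b] h <= 0.
Proof.
move=> hi h0.
pose Ns : set (measurableTypeR R) := [set` N].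
have cN : countable Ns by exact/finite_set_countable/finite_seq.
have mN : measurable Ns by apply: countable_measurable => // x; exact: measurable_set1.
have N0 : mu Ns = 0%E by exact: countable_lebesgue_measure0.
rewrite /Rintegral (negligible_integral mN _ hi N0); last exact: mitv.
rewrite -[leLHS]opprK oppr_le0 -fineN -integralN /=.
  apply: fine_ge0; apply: integral_ge0 => s [/= sab sN]; rewrite lee_fin oppr_ge0.
  by apply: h0; [move: sab; rewrite in_itv|apply/negP].
apply: integrable_add_def => //.
  by apply: measurableD => //; exact: mitv.
by apply: integrableS hi => //; apply: measurableD => //; exact: mitv.
Qed.

Lemma mx_piecewise_primitive (T : R) p q (P : R -> 'M[C]_(p, q)) : 0 < T ->
  mx_piecewise_C1 0 T P -> mx_primitive 0 T P (mx_deriv P).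
Proof.
move=> T0 pP i j; have [pr pi] := pP i j.
split; under [X in primitive _ _ _ X]eq_fun do rewrite mxE /=.
  exact: piecewise_ftc.
exact: piecewise_ftc.
Qed.

Lemma mx_piecewise_derivable (a b : R) p q (P : R -> 'M[C]_(p, q)) :
  mx_piecewise_C1 a b P ->
  exists N : seq R, forall s, a < s < b -> s \notin N -> mx_derivable P s.
Proof.
move=> pP.
have /fin_all_exists [N NP] : forall ij : 'I_p * 'I_q, exists N : seq R, forall s,
    a < s < b -> s \notin N ->
    derivable (fun s => complex.Re (P s ij.1 ij.2)) s 1 /\
    derivable (fun s => complex.Im (P s ij.1 ij.2)) s 1.
  move=> [i j]; have [[_ [Nr [dr _ _]]] [_ [Ni [di _ _]]]] := pP i j.
  exists (Nr ++ Ni) => s sab; rewrite mem_cat negb_or => /andP[sr si].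
  by split; [exact: (dr s sab sr).1|exact: (di s sab si).1].
exists (flatten [seq N ij | ij <- enum predT]) => s sab sN i j.
apply: (NP (i, j)) => //; apply: contra sN => sN.
by apply/flattenP; exists (N (i, j)) => //; apply: map_f; rewrite mem_enum.
Qed.

End MatrixCalculus.

(** * The timer *)

Section Timer.
Variables (R : realType) (t : nat -> R) (ht : jump_times t).

Lemma jump_times_mono j k : (j <= k)%N -> t j <= t k.
Proof.
move=> jk; apply: (@homo_leq _ t (fun x y => x <= y)) jk => //.
  by move=> y x z; exact: le_trans.
by move=> i; apply/ltW; have [] := ht.
Qed.

Lemma timerE k s : t k <= s < t k.+1 -> timer t s = s - t k.
Proof.
move=> /andP[ks sk]; rewrite /timer; congr (_ - t _).
case: xgetP => [j _ /andP[js sj]|/(_ k)]; last by rewrite /= ks sk => /(_ isT).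
apply/eqP; rewrite eqn_leq; apply/andP; split.
  by rewrite leqNgt; apply/negP => /jump_times_mono kj; lra.
by rewrite leqNgt; apply/negP => /jump_times_mono jk; lra.
Qed.

End Timer.

(** * Admissibility of linear gains *)

Section Frobenius.
Variable R : realType.
Local Notation C := R[i].

Lemma rinner_ge0 p q (A : 'M[C]_(p, q)) : 0 <= rinner A A.
Proof.
rewrite rinnerE; apply: sumr_ge0 => i _; apply: sumr_ge0 => j _.
by rewrite addr_ge0 // -expr2 sqr_ge0.
Qed.

Lemma inner_real p q (A : 'M[C]_(p, q)) : inner A A = (rinner A A)%:C%C.
Proof.
have : 0 <= inner A A.
  rewrite /inner /mxtrace; apply: sumr_ge0 => i _; rewrite mxE; apply: sumr_ge0 => j _.
  by rewrite !mxE mul_conjC_ge0.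
rewrite lecE => /andP[/eqP /= i0 _]; rewrite /rinner.
by apply/eqP; rewrite eq_complex /= i0 !eqxx.
Qed.

Lemma frob_adj p q (A : 'M[C]_(p, q)) : frob A^H = frob A.
Proof.
rewrite /frob !rinnerE exchange_big; congr Num.sqrt.
apply: eq_bigr => i _; apply: eq_bigr => j _; rewrite !mxE.
by case: (A i j) => u v /=; rewrite mulrNN.
Qed.

(** Cauchy-Schwarz for each row of [A] against each column of [B]. *)
Lemma frob_mul_le p q r (A : 'M[C]_(p, q)) (B : 'M[C]_(q, r)) :
  frob (A *m B) <= frob A * frob B.
Proof.
rewrite /frob -sqrtrM ?rinner_ge0 // ler_sqrt ?mulr_ge0 ?rinner_ge0 //.
rewrite -lecR rmorphM /= -!inner_real.
rewrite {3}/inner mxtrace_mulC.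
pose a i := dotmx (row i A) (row i A); pose b j := dotmx (row j B^H) (row j B^H).
have -> : inner A A = \sum_i a i.
  by apply: eq_bigr => i _; rewrite /a dotmxE !mxE; apply: eq_bigr => k _; rewrite !mxE.
have -> : \tr (B^H *m B) = \sum_j b j.
  apply: eq_bigr => j _; rewrite /b dotmxE !mxE; apply: eq_bigr => k _.
  by rewrite !mxE conjCK.
rewrite /inner /mxtrace mulr_suml; apply: ler_sum => i _.
rewrite mxE mulr_sumr; apply: ler_sum => j _.
have -> : (A *m B) i j * (A *m B)^H j i = `|dotmx (row i A) (row j B^H)| ^+ 2.
  rewrite normCK; have -> : dotmx (row i A) (row j B^H) = (A *m B) i j.
    rewrite dotmxE !mxE; apply: eq_bigr => k _.
    by rewrite !mxE conjCK.
  by rewrite !mxE.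
exact: (CauchySchwarz (@dotmx _ q) (row i A) (row j B^H)).1.
Qed.

(** A linear gain [K] returns both [K X1] and the covariance [K X1 K^H]; the linear
    term is absorbed by [|K| <= 1 + |K|^2], so that square integrability of [K]
    makes the constant integrable. *)
Lemma gain_lipschitz p q (K : 'M[C]_(p, q)) (W : 'M[C]_q) :
  frob (K *m W) + frob (K *m W *m K^H) <= (1 + 2 * frob K ^+ 2) * frob W.
Proof.
have KW := frob_mul_le K W.
have W0 : 0 <= frob W by exact: sqrtr_ge0.
have K0 : 0 <= frob K by exact: sqrtr_ge0.
have KWK := frob_mul_le (K *m W) K^H; rewrite frob_adj in KWK.
have KWK' : frob (K *m W *m K^H) <= frob K ^+ 2 * frob W.
  by apply: le_trans KWK _; rewrite expr2 mulrAC ler_wpM2r.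
have K1 : frob K <= 1 + frob K ^+ 2.
  by have := sqr_ge0 (frob K - 1); rewrite sqrrB1 => h; nra.
apply: le_trans (lerD KW KWK') _; rewrite -mulrDl ler_wpM2r //.
by rewrite mulr_natl mulr2n addrA lerD2r.
Qed.

End Frobenius.

Section Measurability.
Variable R : realType.
Local Notation C := R[i].

Lemma mx_measurable_cst (D : set R) p q (A : 'M[C]_(p, q)) :
  mx_measurable_on D (fun=> A).
Proof. by move=> i j; split; exact: measurable_cst. Qed.

Lemma mx_measurable_mul (D : set R) p q r (f : R -> 'M[C]_(p, q)) (g : R -> 'M[C]_(q, r)) :
  mx_measurable_on D f -> mx_measurable_on D g ->
  mx_measurable_on D (fun s => f s *m g s).
Proof.
move=> mf mg i j; split.
  have -> : (fun s => complex.Re ((f s *m g s) i j)) = fun s =>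
      \sum_k (complex.Re (f s i k) * complex.Re (g s k j)
             - complex.Im (f s i k) * complex.Im (g s k j)).
    apply/funext => s; rewrite mxE raddf_sum; apply: eq_bigr => k _.
    by case: (f s i k) (g s k j) => [a b] [c d].
  apply: measurable_sum => k; apply: measurable_funB; apply: measurable_funM.
  - exact: (mf _ _).1.
  - exact: (mg _ _).1.
  - exact: (mf _ _).2.
  - exact: (mg _ _).2.
have -> : (fun s => complex.Im ((f s *m g s) i j)) = fun s =>
    \sum_k (complex.Re (f s i k) * complex.Im (g s k j)
           + complex.Im (f s i k) * complex.Re (g s k j)).
  apply/funext => s; rewrite mxE raddf_sum; apply: eq_bigr => k _.
  by case: (f s i k) (g s k j) => [a b] [c d].
apply: measurable_sum => k; apply: measurable_funD; apply: measurable_funM.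
- exact: (mf _ _).1.
- exact: (mg _ _).2.
- exact: (mf _ _).2.
- exact: (mg _ _).1.
Qed.

Lemma mx_measurable_adj (D : set R) p q (f : R -> 'M[C]_(p, q)) :
  mx_measurable_on D f -> mx_measurable_on D (fun s => (f s)^H).
Proof.
move=> mf i j; have [mr mi] := mf j i; split.
  by apply: eq_measurable_fun mr => s _; rewrite !mxE; case: (f s j i).
apply: eq_measurable_fun (measurable_funN mi) => s _; rewrite !mxE.
by rewrite /=; case: (f s j i).
Qed.

Variables (t : nat -> R) (ht : jump_times t).

Lemma jump_interval_cover : `[t 0%N, +oo[%classic = \bigcup_k `[t k, t k.+1[%classic.
Proof.
apply/seteqP; split => s /=; rewrite in_itv /= ?andbT; last first.
  move=> [k _] /=; rewrite in_itv /= => /andP[ks _].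
  by rewrite (le_trans _ ks) // jump_times_mono.
move=> t0s.
have exm : exists m, s < t m.
  have [_ /cvgryPgt /(_ s)] := ht.
  by move=> [m _ /(_ m (leqnn m))]; exists m.
case: (ex_minnP exm) => -[|k] sk mink; first by rewrite ltNge t0s in sk.
exists k => //=; rewrite in_itv /= sk andbT leNgt; apply/negP => /mink.
by rewrite ltnn.
Qed.

Lemma timer_measurable : measurable_fun `[t 0%N, +oo[ (timer t).
Proof.
rewrite jump_interval_cover; apply/measurable_fun_bigcup => k.
  exact: measurable_itv.
have ms : measurable_fun `[t k, t k.+1[ (fun s => s - t k).
  by apply: measurable_funB.
apply: eq_measurable_fun ms => s.
by rewrite mem_setE in_itv /= => /(timerE ht) ->.
Qed.

Lemma timer_ge0 s : t 0%N <= s -> 0 <= timer t s.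
Proof.
move=> t0s; have : `[t 0%N, +oo[%classic s by rewrite /= in_itv /= t0s.
rewrite jump_interval_cover => -[k _] /=; rewrite in_itv /= => ks.
by rewrite (timerE ht ks) subr_ge0; case/andP: ks.
Qed.

Lemma mx_measurable_timer T p q (K : R -> 'M[C]_(p, q)) : 0 <= T ->
  mx_measurable_on `[0, T] K ->
  mx_measurable_on `[t 0%N, +oo[ (fun s => K (Num.min (timer t s) T)).
Proof.
move=> T0 mK i j; have [mr mi] := mK i j.
have comp (g : R -> R) : measurable_fun `[0, T] g ->
    measurable_fun `[t 0%N, +oo[ (fun s => g (Num.min (timer t s) T)).
  move=> mg; apply: (measurable_comp _ _ mg); first exact: measurable_itv.
    move=> _ [s + <-]; rewrite /= !in_itv /= andbT => t0s.
    by rewrite le_min T0 timer_ge0 // ge_min lexx orbT.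
  by apply: measurable_minr; [exact: timer_measurable|exact: measurable_cst].
split; [exact: comp mr|exact: comp mi].
Qed.

(** On each interval between jumps the integrand is a translate of
    [s |-> g (min s T)], and finitely many intervals cover [[t 0, b]]. *)
Lemma real_integrable_timer T b (g : R -> R) : 0 <= T -> t 0%N <= b ->
  real_integrable `[0, T] g ->
  real_integrable `[t 0%N, b] (fun s => g (Num.min (timer t s) T)).
Proof.
move=> T0 t0b gi.
have gmin c : 0 <= c -> real_integrable `[0, c] (fun s => g (Num.min s T)).
  move=> c0; have [cT|Tc] := leP c T.
    have gc : real_integrable `[0, c] g.
      apply: real_integrable_sub gi; [exact: mitv|exact: mitv|].
      by apply: subset_itvl; rewrite bnd_simp.
    apply: eq_real_integrable gc => [|s]; first exact: mitv.
    by rewrite mem_setE in_itv /= => /andP[_ sc]; rewrite min_l // (le_trans sc).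
  apply: (real_integrable_itv_cat T0 (ltW Tc)).
    apply: eq_real_integrable gi => [|s]; first exact: mitv.
    by rewrite mem_setE in_itv /= => /andP[_ sc]; rewrite min_l.
  apply: (@eq_real_integrable _ _ (fun=> g T)); first exact: mitv.
    by move=> s; rewrite mem_setE in_itv /= => /andP[Ts _]; rewrite min_r.
  apply: continuous_compact_integrable; first exact: segment_compact.
  by move=> ?; exact: cvg_cst.
have gk k : real_integrable `[t 0%N, t k] (fun s => g (Num.min (timer t s) T)).
  elim: k => [|k IHk].
    have i0 : real_integrable `[t 0%N, t 0%N] (fun=> 0).
      apply: continuous_compact_integrable; first exact: segment_compact.
      by move=> ?; exact: cvg_cst.
    have e0 : {in `]t 0%N, t 0%N[, (fun=> 0) =1
                  (fun s => g (Num.min (timer t s) T))}.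
      by move=> s; rewrite in_itv /= => /andP[/lt_trans h /h]; rewrite ltxx.
    by have [] := Rintegral_interior e0 i0.
  have tk : t k < t k.+1 by have [] := ht.
  apply: (real_integrable_itv_cat (jump_times_mono ht (leq0n k)) (ltW tk) IHk).
  have d0 : 0 <= t k.+1 - t k by rewrite subr_ge0 ltW.
  have [+ _] := Rintegral_shift (t k) (gmin _ d0).
  rewrite add0r subrK => gs.
  have eqk : {in `]t k, t k.+1[, (fun s => g (Num.min (s - t k) T))
                                 =1 (fun s => g (Num.min (timer t s) T))}.
    move=> s; rewrite in_itv /= => /andP[ks sk].
    by rewrite (@timerE _ _ ht k) // ltW.
  by have [] := Rintegral_interior eqk gs.
have [m bm] : exists m, b <= t m.
  have [_ /cvgryPge /(_ b)] := ht.
  by move=> [m _ /(_ m (leqnn m))]; exists m.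
apply: real_integrable_sub (gk m); [exact: mitv|exact: mitv|].
by apply: subset_itvl; rewrite bnd_simp.
Qed.

End Measurability.

Section Admissibility.
Variables (R : realType) (n mu : nat).
Local Notation C := R[i].

Lemma gain_compatible (X1 : 'M[C]_n) (K : 'M[C]_(mu, n)) :
  psd X1 -> compatible X1 (K *m X1, K *m X1 *m K^H).
Proof.
move=> pX; rewrite /compatible /=.
have := psd_congr (col_mx 1%:M K)^H pX.
rewrite adjmxK adj_col_mx adjmx1 mul_col_mx mul_col_row mul1mx !mulmx1.
by rewrite adjmxM (psd_herm pX).
Qed.

Lemma gain_policy_admissible (t : nat -> R) (Tmin : R)
    (Ku : R -> 'M[C]_(mu, n)) (Kju : 'M[C]_(mu, n)) :
  jump_times t -> 0 < Tmin -> regular_gain Tmin Ku ->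
  admissible t (run t (gain_policy Tmin Ku Kju)).
Proof.
move=> ht hT [mK iK].
pose K s := Ku (Num.min (timer t s) Tmin).
have mKt := mx_measurable_timer ht (ltW hT) mK.
split.
- by move=> s X1 _ pX; exact: gain_compatible.
- by move=> k X1 _ pX; exact: gain_compatible.
- move=> X1 _.
  have mKX := mx_measurable_mul mKt (mx_measurable_cst _ X1).
  by split=> //; apply: mx_measurable_mul => //; exact: mx_measurable_adj.
- exists (fun s => 1 + 2 * frob (K s) ^+ 2); split.
  + move=> b tb.
    have i1 : real_integrable `[t 0%N, b] (fun=> 1).
      apply: continuous_compact_integrable; first exact: segment_compact.
      by move=> ?; exact: cvg_cst.
    have iK2 := real_integrable_timer ht (ltW hT) tb iK.
    exact: (real_integrableD (mitv _) i1 (real_integrableZ 2 (mitv _) iK2)).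
  + move=> s X1 Y1 _ _ _ /=.
    by rewrite -mulmxBr -mulmxBl -mulmxBr; exact: gain_lipschitz.
  + move=> s _ /=; rewrite mulmx0 mul0mx /frob.
    have -> : rinner (0 : 'M[C]_mu) 0 = 0.
      by rewrite /rinner /inner mul0mx raddf0 raddf0.
    by rewrite sqrtr0 addr_ge0 // mulr_ge0 // sqr_ge0.
Qed.

End Admissibility.

(** * Dissipation along trajectories *)

Lemma psd_state (R : realType) n mu mw (X : 'M[R[i]]_(n + (mu + mw))) :
  psd X -> psd (state X).
Proof.
by move=> pX; have := psd_congr (Emx R n (mu + mw))^H pX; rewrite adjmxK.
Qed.

Lemma closed_loop_blocks (R : realType) n mu mw (Ku : 'M[R[i]]_(mu, n))
    (Kw : 'M[R[i]]_(mw, n)) (X1 : 'M[R[i]]_n) :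
  X12 (closed_loop Ku Kw X1) = Ku *m X1 /\
  X22 (closed_loop Ku Kw X1) = Ku *m X1 *m Ku^H.
Proof.
have LX : col_mx 1%:M (col_mx Ku Kw) *m X1
    = col_mx X1 (col_mx (Ku *m X1) (Kw *m X1)) by rewrite !mul_col_mx mul1mx.
rewrite /closed_loop LX !adj_col_mx adjmx1 mul_col_row.
rewrite /X12 /X22 block_mxKdl block_mxKdr mulmx1 col_mxKu.
by rewrite mul_col_row block_mxKul.
Qed.

(** The saddle play of both players is one of the responses to the minimizer's
    policy, so it needs no separate estimate. *)
Lemma saddle_play_follows (R : realType) n mu mw (Tmin : R)
    (Ku : R -> 'M[R[i]]_(mu, n)) (Kw : R -> 'M[R[i]]_(mw, n))
    (Kju : 'M[R[i]]_(mu, n)) (Kjw : 'M[R[i]]_(mw, n)) t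
    (x : play R n mu mw) :
  saddle_play Tmin Ku Kw Kju Kjw t x ->
  follows t (run t (gain_policy Tmin Ku Kju)) x.
Proof.
have blocks X (K : 'M[R[i]]_(mu, n)) (K' : 'M[R[i]]_(mw, n)) :
    X = closed_loop K K' (state X) ->
    (X12 X, X22 X) = (K *m state X, K *m state X *m K^H).
  have [e1 e2] := closed_loop_blocks K K' (state X).
  by move=> XE; rewrite {1 2}XE e1 e2.
move=> [hf hj]; split=> [s ts|k k0]; first exact: blocks (hf s ts).
exact: blocks (hj k k0).
Qed.

Section Certificate.
Variables (R : realType) (n mu mw : nat) (D : game R n mu mw).
Hypothesis hD : standing_assumptions D.
Variables (Tmin : R) (hTmin : 0 < Tmin).
Variables (Finf : 'M[R[i]]_(n + (mu + mw)) -> 'M[R[i]]_n)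
  (Finf_adj : 'M[R[i]]_n -> 'M[R[i]]_(n + (mu + mw))).
Hypothesis hFinf :
  forall tau X, Tmin <= tau -> X \is hermsymmx -> flow D tau X = Finf X.
Hypothesis hFinf_adj : is_adjoint Finf Finf_adj.
Hypothesis hZinf :
  forall tau, Tmin <= tau -> flow_weight D tau = flow_weight D Tmin.
Variable Ps : R -> 'M[R[i]]_n.
Hypothesis hPs_psd : forall tau, 0 <= tau <= Tmin -> psd (Ps tau).
Hypothesis hPs_C1 : mx_piecewise_C1 0 Tmin Ps.
Hypothesis h_flow : forall tau, 0 < tau < Tmin -> mx_derivable Ps tau ->
  schur (HJI D Ps tau) = 0 /\ isaacs (HJI D Ps tau).
Hypothesis h_jump : isaacs (HJI_jump D (Ps 0) (Ps Tmin)) /\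
  schur (HJI_jump D (Ps 0) (Ps Tmin)) = 0.
Hypothesis h_GC : isaacs (Finf_adj (Ps Tmin) + flow_weight D Tmin) /\
  nsd (schur (Finf_adj (Ps Tmin) + flow_weight D Tmin)).
Variables (Ku : R -> 'M[R[i]]_(mu, n)) (Kw : R -> 'M[R[i]]_(mw, n)).
Variables (Kju : 'M[R[i]]_(mu, n)) (Kjw : 'M[R[i]]_(mw, n)).
Hypothesis hK : forall tau, 0 <= tau <= Tmin ->
  saddle_gains (HJI D Ps tau) (Ku tau) (Kw tau).
Hypothesis hKj : saddle_gains (HJI_jump D (Ps 0) (Ps Tmin)) Kju Kjw.

Local Notation lambda := (@lebesgue_measure R).

Let Z_herm tau : 0 <= tau -> (flow_weight D tau)^H = flow_weight D tau.
Proof. by move=> t0; have [/(_ tau t0) [_ _ []] /herm_adjP] := hD. Qed.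

Let Ps_herm tau : 0 <= tau <= Tmin -> Ps tau \is hermsymmx.
Proof. by move=> /hPs_psd []. Qed.

Let flow_adj_herm tau P : 0 <= tau -> P \is hermsymmx ->
  (flow_adj D tau P)^H = flow_adj D tau P.
Proof. by move=> t0 hP; have [/(_ tau t0) [_ [h _] _] _] := hD; apply/herm_adjP/h. Qed.

(** The integrand of [dV/dt + <Z, X>]: below [Tmin] it is a pairing with the HJI
    matrix, from [Tmin] on a pairing with the frozen matrix of the
    Geromel-Colaneri condition. *)
Lemma flow_rate_le0 tau X : 0 < tau -> (tau < Tmin -> mx_derivable Ps tau) ->
  psd X -> X12 X = Ku (Num.min tau Tmin) *m state X ->
  X22 X = Ku (Num.min tau Tmin) *m state X *m (Ku (Num.min tau Tmin))^H ->
  rinner (if tau < Tmin then mx_deriv Ps tau else 0) (state X)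
  + rinner (Ps (Num.min tau Tmin)) (flow D tau X)
  + rinner (flow_weight D tau) X <= 0.
Proof.
move=> tau0 dP pX; have hX := pX.1.
have [/(_ tau (ltW tau0)) [_ adj _] _] := hD.
have [tauT|Ttau] := ltP tau Tmin => x12 x22.
  have tT : 0 <= tau <= Tmin by rewrite !ltW.
  have [sch isa] : schur (HJI D Ps tau) = 0 /\ isaacs (HJI D Ps tau).
    by apply: h_flow; [rewrite tau0|exact: dP].
  rewrite (rinner_adjoint adj (Ps_herm tT) hX) -addrA -rinnerDl.
  have hN : (flow_adj D tau (Ps tau) + flow_weight D tau)^H =
            flow_adj D tau (Ps tau) + flow_weight D tau.
    by rewrite adjmxD flow_adj_herm ?Ps_herm ?Z_herm ?ltW.
  have sE := addrA ((Emx R n (mu + mw))^H *m mx_deriv Ps tau *m Emx R n (mu + mw))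
    (flow_adj D tau (Ps tau)) (flow_weight D tau).
  rewrite -/(HJI D Ps tau) in sE.
  have [e1 e2 e3] := Emx_congr_blocks (mx_deriv Ps tau)
    (flow_adj D tau (Ps tau) + flow_weight D tau).
  apply: (hji_dissipation hN (Kw := Kw tau) _ _ _ pX x12 x22).
  - by rewrite sE.
  - by rewrite sE sch /nsd oppr0; exact: psd0.
  - by apply: saddle_gains_ext (hK tT); rewrite -?e1 -?e3 sE.
have TT : 0 <= Tmin <= Tmin by rewrite lexx ltW.
rewrite (hFinf Ttau hX) (hZinf Ttau) (rinner_adjoint hFinf_adj (Ps_herm TT) hX).
rewrite -addrA -rinnerDl.
have FE : Finf_adj (Ps Tmin) = flow_adj D Tmin (Ps Tmin).
  have [/(_ Tmin (ltW hTmin)) [_ adjT _] _] := hD.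
  apply: (adjoint_unique hFinf_adj adjT _ (Ps_herm TT)) => Y hY.
  by rewrite hFinf.
have hN : (Finf_adj (Ps Tmin) + flow_weight D Tmin)^H =
          Finf_adj (Ps Tmin) + flow_weight D Tmin.
  have T0 := ltW hTmin; rewrite adjmxD FE flow_adj_herm ?Z_herm //; exact: Ps_herm.
have E0 : (Emx R n (mu + mw))^H *m 0 *m Emx R n (mu + mw)
   + (Finf_adj (Ps Tmin) + flow_weight D Tmin) = Finf_adj (Ps Tmin) + flow_weight D Tmin.
  by rewrite mulmx0 mul0mx add0r.
have [e1 e2 e3] := Emx_congr_blocks (mx_deriv Ps Tmin)
  (Finf_adj (Ps Tmin) + flow_weight D Tmin).
apply: (hji_dissipation hN (Kw := Kw Tmin) _ _ _ pX x12 x22); rewrite ?E0.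
- exact: h_GC.1.
- exact: h_GC.2.
- by apply: saddle_gains_ext (hK TT); rewrite -?e1 -?e3 FE addrA.
Qed.

Lemma jump_rate_le0 X : psd X -> X12 X = Kju *m state X ->
  X22 X = Kju *m state X *m Kju^H ->
  rinner (Ps 0) (jump D X) + rinner (jump_weight D) X <= rinner (Ps Tmin) (state X).
Proof.
move=> pX x12 x22; have [_ [_ [_ [_ adj [hZ _ _ _ _] _]]]] := hD.
have P0 : Ps 0 \is hermsymmx by apply: Ps_herm; rewrite lexx ltW.
rewrite (rinner_adjoint adj P0 pX.1) -subr_le0 addrC -rinnerNl.
have hN : (jump_adj D (Ps 0) + jump_weight D)^H = jump_adj D (Ps 0) + jump_weight D.
  by rewrite adjmxD; congr (_ + _); apply/herm_adjP => //; exact: adj.1.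
rewrite -rinnerDl.
have sE : (Emx R n (mu + mw))^H *m (- Ps Tmin) *m Emx R n (mu + mw)
    + (jump_adj D (Ps 0) + jump_weight D) = HJI_jump D (Ps 0) (Ps Tmin).
  by rewrite mulmxN mulNmx addrA [- _ + _]addrC.
have [e1 e2 e3] := Emx_congr_blocks (- Ps Tmin)
  (jump_adj D (Ps 0) + jump_weight D).
apply: (hji_dissipation hN (Kw := Kjw) _ _ _ pX x12 x22); rewrite ?sE.
- exact: h_jump.1.
- by rewrite h_jump.2 /nsd oppr0; exact: psd0.
- by apply: saddle_gains_ext hKj; rewrite -?e1 -?e3 sE.
Qed.

Variables (t : nat -> R) (ht : jump_times t).
Hypothesis hdwell : forall k, Tmin <= t k.+1 - t k.
Variables (X10 : 'M[R[i]]_n) (x : play R n mu mw).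
Hypothesis hx : trajectory D t X10 x.
Hypothesis hfollow : follows t (run t (gain_policy Tmin Ku Kju)) x.

Let ell s : R := rinner (flow_weight D (timer t s)) (xflow x s).

Let drift s := flow D (timer t s) (xflow x s).

Let t0_le k : t 0%N <= t k.
Proof. exact: jump_times_mono. Qed.

Let drift_integrable a b : t 0%N <= a -> a <= b ->
  mx_integrable `[a, b] drift /\ real_integrable `[a, b] ell.
Proof.
move=> ta ab; have [[_ _ /(_ b (le_trans ta ab)) [hd hl] _] _] := hx.
have sub h : real_integrable `[t 0%N, b] h -> real_integrable `[a, b] h.
  apply: real_integrable_sub; [exact: mitv|exact: mitv|].
  by apply: subset_itvr; rewrite bnd_simp.
by split; [move=> i j; have [] := hd i j; split; exact: sub|exact: sub].
Qed.

(** Unlike the state itself, this solution of the flow equation extends up to and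
    including the next jump time, where it gives the state before the jump. *)
Definition flow_state k s := state (xflow x (t k)) + mx_int `[t k, s] drift.

Lemma flow_state_primitive k c : t k <= c ->
  mx_primitive (t k) c (flow_state k) drift.
Proof.
move=> kc i j; have [di _] := drift_integrable (t0_le k) kc.
have [dr dm] := di i j.
split; split=> // s ksc; rewrite /flow_state !mxE set_itv1 !Rintegral_set1;
  by rewrite !raddfD /= addr0.
Qed.

Lemma flow_stateE k s : t k <= s < t k.+1 -> state (xflow x s) = flow_state k s.
Proof. by move=> ks; have [[_ _ _ /(_ k s ks)]] := hx. Qed.

(** The integrated flow equation is continuous up to the next jump time, so its
    value there is the left limit of the state. *)
Lemma flow_state_jump k : state (xjump x k.+1) = flow_state k (t k.+1).
Proof.
have tk : t k < t k.+1 by have [] := ht.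
have pY := flow_state_primitive (ltW tk).
have [_ [_ /(_ k.+1 isT) hl _]] := hx.
have side (f g : R -> R) (l : R) h : primitive (t k) (t k.+1) g h ->
    (forall s, t k <= s < t k.+1 -> f s = g s) ->
    f @ (t k.+1)^'- --> l -> l = g (t k.+1).
  move=> /(primitive_continuous (ltW tk)) /(continuous_within_itvP _ tk) [_ _ cg] fg cf.
  apply: cvg_unique cf _; first exact: norm_hausdorff.
  apply: cvg_trans cg; apply: near_eq_cvg; near=> s; apply/esym/fg.
  apply/andP; split; near: s; [exact: nbhs_left_ge|exact: nbhs_left_lt].
apply/matrixP => i j; have [hr hm] := hl i j; have [pr pm] := pY i j.
apply/eqP; rewrite eq_complex; apply/andP; split; apply/eqP.
  by apply: side pr _ hr => s /flow_stateE ->.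
by apply: side pm _ hm => s /flow_stateE ->.
Unshelve. all: by end_near. Qed.

(** The horizon may cut an interval between jumps, hence the arbitrary right end
    [c]; at [c = t k.+1] the weight is [Ps Tmin] by the dwell-time condition. *)
Lemma flow_dissipation k c : t k < c <= t k.+1 ->
  rinner (Ps (Num.min (c - t k) Tmin)) (flow_state k c)
  + Rintegral lambda `[t k, c] ell <= rinner (Ps 0) (state (xflow x (t k))).
Proof.
move=> /andP[kc ck].
have pY := flow_state_primitive (ltW kc).
pose P s := Ps (Num.min (s - t k) Tmin).
pose P' s := if s - t k < Tmin then mx_deriv Ps (s - t k) else 0.
have pP : mx_primitive (t k) c P P'.
  move=> i j; have [pr pm] := mx_piecewise_primitive hTmin hPs_C1 i j.
  have b0 : 0 <= c - t k by rewrite subr_ge0 ltW.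
  have ps F f : primitive 0 Tmin F f ->
    primitive (t k) c (fun s => F (Num.min (s - t k) Tmin))
      (fun s => if s - t k < Tmin then f (s - t k) else 0).
    move=> /(primitive_min (ltW hTmin) b0) /(primitive_shift (t k)).
    by rewrite add0r subrK.
  split.
    have := ps _ _ pr; congr primitive; apply/funext => s; rewrite /P'.
    by case: ifP; rewrite ?mxE.
  have := ps _ _ pm; congr primitive; apply/funext => s; rewrite /P'.
  by case: ifP; rewrite ?mxE.
have [ih E] := mx_primitive_ibp (ltW kc) pP pY.
have Pk : P (t k) = Ps 0 by rewrite /P subrr min_l // ltW.
have Yk : flow_state k (t k) = state (xflow x (t k)).
  rewrite -flow_stateE // lexx /=; have [] := ht => + _; exact.
rewrite Pk Yk in E.
have [_ il] := drift_integrable (t0_le k) (ltW kc).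
rewrite -subr_le0 addrAC E -RintegralD //.
have [N dN] := mx_piecewise_derivable hPs_C1.
(* Excluded: the end points, where the timer jumps or [Ps] need not be
   derivable, and the break points of [Ps]. *)
apply: (@Rintegral_le0_off _ _ _ _ (t k :: c :: [seq tau + t k | tau <- N])).
  by apply: real_integrableD => //; exact: mitv.
move=> s /andP[ks sc]; rewrite !inE !negb_or => /and3P[sk sc' sN].
have {sk} {}ks : t k < s by rewrite lt_neqAle eq_sym sk.
have {sc'} {}sc : s < c by rewrite lt_neqAle sc'.
have sk : t k <= s < t k.+1 by rewrite ltW //= (lt_le_trans sc).
have ts := timerE ht sk.
have t0s : t 0%N <= s by rewrite (le_trans (t0_le k)) // ltW.
have [[/(_ s t0s) pX _ _ _] _] := hx.
have [/(_ s t0s) + _] := hfollow; rewrite /= ts => -[x12 x22].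
rewrite /P /P' /ell /drift -flow_stateE // ts.
apply: flow_rate_le0 => //; first by rewrite subr_gt0.
move=> sT; apply: dN; first by rewrite subr_gt0 ks.
apply: contra sN => sN; apply/mapP; exists (s - t k) => //.
by rewrite subrK.
Qed.

(** Telescoping: every jump starts from [Ps Tmin] and restarts at [Ps 0]. *)
Lemma value_at_jump k :
  rinner (Ps 0) (state (xflow x (t k))) + Rintegral lambda `[t 0%N, t k] ell
  + \sum_(1 <= j < k.+1) rinner (jump_weight D) (xjump x j) <= rinner (Ps 0) X10.
Proof.
elim: k => [|k IHk].
  rewrite set_itv1 Rintegral_set1 big_geq // !addr0.
  by have [_ [-> _ _]] := hx.
apply: le_trans IHk; rewrite big_nat_recr //=.
have tk : t k < t k.+1 by have [] := ht.
have tkk : t k < t k.+1 <= t k.+1 by rewrite tk lexx.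
have := flow_dissipation tkk; rewrite -flow_state_jump min_r // => hf.
have [[_ /(_ k.+1 isT) pX _ _] [_ _ /(_ k.+1 isT) ->]] := hx.
have [_ /(_ k.+1 isT) [x12 x22]] := hfollow.
have hj := jump_rate_le0 pX x12 x22.
have [_ il] := drift_integrable (lexx _) (t0_le k.+1).
rewrite (Rintegral_itv_cat (t0_le k) (ltW tk) il).
have := lerD (le_trans (lerD hj (lexx _)) hf)
  (lexx (Rintegral lambda `[t 0%N, t k] ell
         + \sum_(1 <= j < k.+1) rinner (jump_weight D) (xjump x j))).
by congr (_ <= _); ring.
Qed.

(** Split at the last [t K] before the horizon; what is left of [V] at the horizon
    is nonnegative, so it can be dropped. *)
Lemma cost_bound T : 0 < T -> cost D t T x <= rinner (Ps 0) X10.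
Proof.
move=> T0.
have [K tK] : exists K, t K < t 0%N + T <= t K.+1.
  have exm : exists m, t 0%N + T <= t m.
    have [_ /cvgryPge /(_ (t 0%N + T))] := ht.
    by move=> [m _ /(_ m (leqnn m))]; exists m.
  case: (ex_minnP exm) => -[|K] hK' minK.
    by move: hK'; rewrite gerDl leNgt T0.
  exists K; rewrite hK' andbT ltNge; apply/negP => /minK.
  by rewrite ltnn.
have /andP[Kc cK] := tK.
have hv := value_at_jump K; have hf := flow_dissipation tK.
have pos : 0 <= rinner (Ps (Num.min (t 0%N + T - t K) Tmin)) (flow_state K (t 0%N + T)).
  apply: rinner_psd_ge0.
    apply: hPs_psd; rewrite ge_min lexx orbT andbT le_min subr_ge0.
    by rewrite !ltW.
  have [cK'|cK'] := ltP (t 0%N + T) (t K.+1).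
    rewrite -flow_stateE ?(ltW Kc) //; apply: psd_state.
    have [[/(_ (t 0%N + T)) + _ _ _] _] := hx; apply.
    by rewrite lerDl ltW.
  have -> : t 0%N + T = t K.+1 by apply/eqP; rewrite eq_le cK.
  rewrite -flow_state_jump; apply: psd_state.
  by have [[_ /(_ K.+1 isT)]] := hx.
have [_ il] := drift_integrable (lexx _) (ltW (ltr_pwDr T0 (lexx (t 0%N)))).
rewrite /cost (Rintegral_itv_cat (t0_le K) (ltW Kc) il).
have -> : \sum_(k \in [set k | t 0%N < t k < t 0%N + T])
     rinner (jump_weight D) (xjump x k)
   = \sum_(1 <= j < K.+1) rinner (jump_weight D) (xjump x j).
  have -> : [set k | t 0%N < t k < t 0%N + T] = [set` index_iota 1 K.+1].
    apply/seteqP; split => k /=; rewrite mem_index_iota ltnS.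
      move=> /andP[t0k kT]; apply/andP; split.
        by rewrite lt0n; apply/eqP => k0; rewrite k0 ltxx in t0k.
      rewrite leqNgt; apply/negP => /(jump_times_mono ht) Kk.
      by have := lt_le_trans kT (le_trans cK Kk); rewrite ltxx.
    move=> /andP[k0 kK]; apply/andP; split.
      by apply: (@lt_le_trans _ _ (t 1%N)); [have [] := ht|exact: jump_times_mono].
    by apply: le_lt_trans Kc; exact: jump_times_mono.
  by rewrite -fsbig_seq // iota_uniq.
apply: le_trans hv; rewrite lerD2r [leLHS]addrC lerD2r.
by apply: le_trans hf; rewrite lerDr.
Qed.

End Certificate.

Unset Implicit Arguments.

Theorem theorem6p19 (R : realType) (n mu mw : nat)
  (hn : (0 < n)%N) (hmu : (0 < mu)%N) (hmw : (0 < mw)%N)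
  (D : game R n mu mw) (hD : standing_assumptions D)
  (Tmin : R) (hTmin : 0 < Tmin)
  (Finf : 'M[R[i]]_(n + (mu + mw)) -> 'M[R[i]]_n)
  (Finf_adj : 'M[R[i]]_n -> 'M[R[i]]_(n + (mu + mw)))
  (hFinf : forall tau X, Tmin <= tau -> X \is hermsymmx -> flow D tau X = Finf X)
  (hFinf_adj : is_adjoint Finf Finf_adj)
  (hZinf : forall tau, Tmin <= tau -> flow_weight D tau = flow_weight D Tmin)
  (Ps : R -> 'M[R[i]]_n)
  (hPs_psd : forall tau, 0 <= tau <= Tmin -> psd (Ps tau))
  (hPs_C1 : mx_piecewise_C1 0 Tmin Ps)
  (h_flow : forall tau, 0 < tau < Tmin -> mx_derivable Ps tau ->
     schur (HJI D Ps tau) = 0 /\ isaacs (HJI D Ps tau))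
  (h_jump : isaacs (HJI_jump D (Ps 0) (Ps Tmin)) /\
     schur (HJI_jump D (Ps 0) (Ps Tmin)) = 0)
  (h_GC : isaacs (Finf_adj (Ps Tmin) + flow_weight D Tmin) /\
     nsd (schur (Finf_adj (Ps Tmin) + flow_weight D Tmin)))
  (Ku : R -> 'M[R[i]]_(mu, n)) (Kw : R -> 'M[R[i]]_(mw, n))
  (Kju : 'M[R[i]]_(mu, n)) (Kjw : 'M[R[i]]_(mw, n))
  (hK : forall tau, 0 <= tau <= Tmin ->
     saddle_gains (HJI D Ps tau) (Ku tau) (Kw tau))
  (hKj : saddle_gains (HJI_jump D (Ps 0) (Ps Tmin)) Kju Kjw)
  (hKreg : regular_gain Tmin Ku)
  (t : nat -> R) (ht : jump_times t)
  (hdwell : forall k, Tmin <= t k.+1 - t k)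
  (X10 : 'M[R[i]]_n) (hX10 : psd X10)
  (T : R) (hT : 0 < T) :
  let pi := run t (gain_policy Tmin Ku Kju) in
  [/\ forall x : play R n mu mw, trajectory D t X10 x ->
        saddle_play Tmin Ku Kw Kju Kjw t x ->
        cost D t T x <= rinner (Ps 0) X10,
      admissible t pi,
      (worst_case_cost D t T X10 pi <= (rinner (Ps 0) X10)%:E)%E
    & (upper_value D t T X10 <= (rinner (Ps 0) X10)%:E)%E].
Proof.
move=> pi.
have bound x : trajectory D t X10 x -> follows t pi x ->
    cost D t T x <= rinner (Ps 0) X10.
  move=> hx hf.
  exact: (cost_bound hD hTmin hFinf hFinf_adj hZinf hPs_psd hPs_C1 h_flow
            h_jump h_GC hK hKj ht hdwell hx hf hT).
have adm : admissible t pi by exact: gain_policy_admissible.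
have wc : (worst_case_cost D t T X10 pi <= (rinner (Ps 0) X10)%:E)%E.
  by apply: ub_ereal_sup => _ [x [hx hfollow] <-]; rewrite lee_fin bound.
split=> //.
- by move=> x hx /saddle_play_follows; exact: bound.
- by apply: le_trans wc; apply: ereal_inf_lbound; exists pi.
Qed.
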